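(* For most closed convex curves $C\in\mathcal{C}$, most points of $C^o$ lie in continuum many affine diameters of $C$. That is, there is a comeagre set of curves $C\in\mathcal{C}$ such that the set of those $u\in C^o$ for which the family of affine diameters $[a,b]$ of $C$ with $u\in[a,b]$ has the cardinality of the continuum is comeagre in $C^o$.
   Context: $\mathcal{C}$ is the set of all closed convex curves in the plane $\mathbb{R}^2$ (boundaries of compact convex sets with non-empty interior), equipped with the Hausdorff metric. ''Most'' is meant in the Baire category sense: a property holds for most elements of a space if it holds for all elements of a comeagre (residual) subset. For $C\in\mathcal{C}$, $C^o$ denotes the closed convex set whose boundary is $C$. A segment $[a,b]$ with $a,b\in C$ is an affine diameter of $C$ if there are distinct and parallel tangent (supporting) lines to $C$ at $a$ and at $b$. *)

(* Defs.v *)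
From HB Require Import structures.
From mathcomp Require Import all_boot all_order all_algebra.
From mathcomp Require Import all_classical all_reals all_analysis.
From mathcomp Require Import ring lra.

Set Implicit Arguments.
Unset Strict Implicit.
Unset Printing Implicit Defensive.

Import Order.TTheory GRing.Theory Num.Theory.
Import numFieldNormedType.Exports.

Local Open Scope classical_set_scope.
Local Open Scope card_scope.
Local Open Scope ring_scope.

Definition nowhere_dense (T : topologicalType) (A : set T) : Prop :=
  interior (closure A) = set0.

Definition meagre (T : topologicalType) (A : set T) : Prop :=
  exists2 F : nat -> set T,
    (forall n, nowhere_dense (F n)) & A = \bigcup_n F n.

Definition comeagre (T : topologicalType) (A : set T) : Prop := meagre (~` A).

Definition dot (R : realType) (x y : 'rV[R]_2) : R := \sum_i x 0 i * y 0 i.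

(* The library norm on 'rV[R]_2 is the sup norm, so the Euclidean one is defined
   here; both induce the same topology. *)
Definition enorm (R : realType) (x : 'rV[R]_2) : R := Num.sqrt (dot x x).

Definition segment (R : realType) (a b : 'rV[R]_2) : set 'rV[R]_2 :=
  [set (1 - t) *: a + t *: b | t in `[0, 1]].

Definition boundary (T : topologicalType) (A : set T) : set T :=
  closure A `\` interior A.

Definition dist_to (R : realType) (B : set 'rV[R]_2) (x : 'rV[R]_2) : R :=
  inf [set enorm (x - y) | y in B].

Definition excess (R : realType) (A B : set 'rV[R]_2) : R :=
  sup [set dist_to B x | x in A].

Definition hausdorff_dist (R : realType) (A B : set 'rV[R]_2) : R :=
  Num.max (excess A B) (excess B A).

Definition convex_body (R : realType) (K : set 'rV[R]_2) : Prop :=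
  [/\ compact K, convex_set K & interior K !=set0].

Record convex_curve (R : realType) := ConvexCurve {
  curve_set :> set 'rV[R]_2;
  curveP : exists2 K, convex_body K & boundary K = curve_set }.

(* C^o: the compact convex set with non-empty interior whose boundary is C; it is
   determined by C, see [body_unique]. *)
Definition body (R : realType) (C : convex_curve R) : set 'rV[R]_2 :=
  xget set0 [set K | convex_body K /\ boundary K = C].

Definition line (R : realType) (n : 'rV[R]_2) (c : R) : set 'rV[R]_2 :=
  [set x | dot n x = c].

Definition parallel (R : realType) (L M : set 'rV[R]_2) : Prop :=
  exists n c d, [/\ n != 0, L = line n c & M = line n d].

(* Replacing (n, c) by (- n, - c) exchanges the two half-planes bounded by L,
   so it suffices to mention one of them. *)
Definition supporting_line (R : realType) (C : set 'rV[R]_2) (a : 'rV[R]_2)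
    (L : set 'rV[R]_2) : Prop :=
  [/\ C a, L a & exists n c, [/\ n != 0, L = line n c &
    C `<=` [set x | dot n x <= c]]].

Definition affine_diameter (R : realType) (C S : set 'rV[R]_2) : Prop :=
  exists a b L M, [/\ S = segment a b, supporting_line C a L,
    supporting_line C b M, parallel L M & L <> M].

Lemma dot2E (R : realType) (x y : 'rV[R]_2) :
  dot x y = x 0 0 * y 0 0 + x 0 1 * y 0 1.
Proof.
rewrite /dot big_ord_recl big_ord1.
by congr (_ + x _ _ * y _ _); apply/val_inj.
Qed.

Lemma enorm0 (R : realType) : enorm (0 : 'rV[R]_2) = 0.
Proof. by rewrite /enorm dot2E !mxE !mul0r addr0 sqrtr0. Qed.

Lemma enorm_ge0 (R : realType) (x : 'rV[R]_2) : 0 <= enorm x.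
Proof. exact: sqrtr_ge0. Qed.

Lemma enormN (R : realType) (x : 'rV[R]_2) : enorm (- x) = enorm x.
Proof. by rewrite /enorm !dot2E !mxE !mulrNN. Qed.

Lemma enorm_sub (R : realType) (x y : 'rV[R]_2) : enorm (x - y) = enorm (y - x).
Proof. by rewrite -enormN opprB. Qed.

Lemma enormD (R : realType) (x y : 'rV[R]_2) :
  enorm (x + y) <= enorm x + enorm y.
Proof.
rewrite -(@ler_pXn2r _ 2)// ?nnegrE ?addr_ge0 ?enorm_ge0//.
have d0 (z : 'rV[R]_2) : 0 <= dot z z.
  by rewrite dot2E addr_ge0// -expr2 sqr_ge0.
rewrite sqrrD /enorm !sqr_sqrtr// -sqrtrM//.
have : dot x y <= Num.sqrt (dot x x * dot y y).
  have [xy0|xy0] := lerP (dot x y) 0; first by rewrite (le_trans xy0)// sqrtr_ge0.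
  rewrite -(ger0_norm (ltW xy0)) -sqrtr_sqr ler_wsqrtr//.
  rewrite !dot2E -subr_ge0.
  rewrite (_ : _ - _ = (x 0 0 * y 0 1 - x 0 1 * y 0 0) ^+ 2) ?sqr_ge0//.
  by ring.
rewrite !dot2E !mxE => h.
lra.
Qed.

Lemma enorm_le (R : realType) (x : 'rV[R]_2) : enorm x <= 2 * `|x|.
Proof.
have xi i : `|x 0 i| <= `|x| by rewrite {2}/Num.norm/= mx_normrE; exact: (le_bigmax _ (fun ij => `|x ij.1 ij.2|) (0, i)).
rewrite -[leRHS]ger0_norm ?mulr_ge0// -sqrtr_sqr ler_wsqrtr// dot2E.
have s i : x 0 i * x 0 i <= `|x| ^+ 2.
  by rewrite -expr2 -real_normK ?num_real// ler_pXn2r// ?nnegrE.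
by have := s 0; have := s 1; have := sqr_ge0 (`|x|); rewrite exprMn; lra.
Qed.

Lemma norm_le_enorm (R : realType) (x : 'rV[R]_2) : `|x| <= enorm x.
Proof.
rewrite {1}/Num.norm/= mx_normrE; apply/bigmax_leP; split => [|[i j] _ /=].
  exact: enorm_ge0.
rewrite (ord1 i) -sqrtr_sqr /enorm ler_wsqrtr// /dot (bigD1 j)//= -expr2.
by rewrite lerDl sumr_ge0// => k _; rewrite -expr2 sqr_ge0.
Qed.

(* A ray from a point of a compact set leaves it through the boundary. *)
Lemma ray_boundary (R : realType) (K : set 'rV[R]_2) (x v : 'rV[R]_2) :
  compact K -> K x -> v != 0 -> exists2 t : R, 0 <= t & boundary K (x + t *: v).
Proof.
move=> cK Kx v0.
have clK : closed K by apply: compact_closed => //; exact: norm_hausdorff.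
have [M [_ KM]] := compact_bounded cK.
have {}KM y : K y -> `|y| <= M + 1 by move=> Ky; apply: (KM (M + 1)) => //; rewrite ltrDl.
pose S := [set t : R | 0 <= t /\ K (x + t *: v)].
have S0 : S 0 by split => //; rewrite scale0r addr0.
have nv : 0 < `|v| by rewrite normr_gt0.
have ubS : ubound S ((M + 1 + `|x|) / `|v|).
  move=> t [t0 Kt]; rewrite ler_pdivlMr// -(ger0_norm t0) -normrZ.
  rewrite -[t *: v](addKr x) addrC (le_trans (ler_normB _ _))// lerD2r.
  exact: KM.
have hS : has_ubound S by exists ((M + 1 + `|x|) / `|v|).
have s0 : 0 <= sup S by exact: (ub_le_sup hS).
have Ks : K (x + sup S *: v).
  have cf : continuous (fun t : R => x + t *: v).
    by move=> t; apply: cvgD; [exact: cvg_cst|exact: cvgZr_tmp].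
  apply: (@preimage_closed _ _ _ K (fun t _ => cf t) clK).
  by apply: closureS (closure_sup (ex_intro _ _ S0) hS) => t [].
exists (sup S) => //; split; first exact: subset_closure.
rewrite /interior => /nbhs_ballP[e /= e0 eK].
have : S (sup S + e / 2 / `|v|).
  split; first by rewrite addr_ge0// !divr_ge0// ltW.
  apply: eK; rewrite -ball_normE/= scalerDl addrA opprD addNKr.
  rewrite normrN normrZ ger0_norm ?divr_ge0 ?ltW// -?mulrA ?mulVf ?gt_eqF//.
  by rewrite mulr1; lra.
move/(ub_le_sup hS).
have : 0 < e / 2 / `|v| by rewrite !divr_gt0.
lra.
Qed.

Lemma body_spec (R : realType) (C : convex_curve R) :
  convex_body (body C) /\ boundary (body C) = C.
Proof.
rewrite /body; case: xgetP => [K _ //|none].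
by have [K K1 K2] := curveP C; case: (none K).
Qed.

Lemma sub_of_boundary (R : realType) (K L : set 'rV[R]_2) :
  compact K -> compact L -> convex_set L -> boundary K `<=` L -> K `<=` L.
Proof.
move=> cK cL vL KL x Kx.
pose e : 'rV[R]_2 := delta_mx 0 0.
have e0 : e != 0.
  by apply/eqP => /matrixP/(_ 0 0)/eqP; rewrite !mxE !eqxx oner_eq0.
have [t t0 /KL Lt] := ray_boundary cK Kx e0.
have [s s0 /KL] : exists2 s : R, 0 <= s & boundary K (x + s *: - e).
  by apply: ray_boundary => //; rewrite oppr_eq0.
have [ts0 _|ts0 Ls] := eqVneq (t + s) 0.
  have t00 : t = 0 by lra.
  by move: Lt; rewrite t00 scale0r addr0.
have ts : 0 < t + s by rewrite lt_def ts0 addr_ge0.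
have k0 : 0 <= s / (t + s) by rewrite divr_ge0// ltW.
have k1 : s / (t + s) <= 1 by rewrite ler_pdivrMr// mul1r lerDr.
pose k : {i01 R} := Itv01 k0 k1.
have /set_mem := vL _ _ k (mem_set Lt) (mem_set Ls).
congr L; apply/rowP => i; rewrite !mxE /= /unstable.onem.
by field.
Qed.

Lemma body_unique (R : realType) (C : convex_curve R) (K : set 'rV[R]_2) :
  convex_body K -> boundary K = C -> K = body C.
Proof.
move=> [cK vK _] bK; have [[cB vB _] bB] := body_spec C.
have hb (A : set 'rV[R]_2) : compact A -> boundary A `<=` A.
  move=> cA x [+ _]; have /closure_id <- // : closed A.
  by apply: compact_closed => //; exact: norm_hausdorff.
by apply/seteqP; split; apply: sub_of_boundary => //; rewrite ?bK -?bB -?bK ?bB;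
  [rewrite -bB; exact: hb|rewrite -bK; exact: hb].
Qed.

Lemma curve_nonempty (R : realType) (C : convex_curve R) : C !=set0.
Proof.
have [[cK _ [x Kx]] <-] := body_spec C.
have e0 : delta_mx 0 0 != 0 :> 'rV[R]_2.
  by apply/eqP => /matrixP/(_ 0 0)/eqP; rewrite !mxE !eqxx oner_eq0.
have [t _ bt] := ray_boundary cK (interior_subset Kx) e0.
by exists (x + t *: delta_mx 0 0).
Qed.

Lemma curve_closed (R : realType) (C : convex_curve R) : closed C.
Proof.
have [_ <-] := body_spec C; rewrite /boundary setDE.
by apply: closedI; [exact: closed_closure|exact/open_closedC/open_interior].
Qed.

Lemma curve_bounded (R : realType) (C : convex_curve R) :
  exists M : R, forall x, curve_set C x -> enorm x <= M.
Proof.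
have [[cK _ _] <-] := body_spec C.
have clK : closed (body C).
  by apply: compact_closed => //; exact: norm_hausdorff.
have [M [_ KM]] := compact_bounded cK.
exists (2 * (M + 1)) => x [+ _]; move/closure_id : (clK) => <- Kx.
rewrite (le_trans (enorm_le _))// ler_pM2l//.
by apply: (KM (M + 1)) => //; rewrite ltrDl.
Qed.

Lemma dist_to_le (R : realType) (B : set 'rV[R]_2) (x y : 'rV[R]_2) :
  B y -> dist_to B x <= enorm (x - y).
Proof.
move=> By; apply: ge_inf; last by exists y.
by exists 0 => _ [z _ <-]; exact: enorm_ge0.
Qed.

Lemma dist_to_ge (R : realType) (B : set 'rV[R]_2) (x : 'rV[R]_2) (r : R) :
  B !=set0 -> (forall y, B y -> r <= enorm (x - y)) -> r <= dist_to B x.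
Proof.
move=> [b Bb] h; apply: lb_le_inf; first by exists (enorm (x - b)); exists b.
by move=> _ [y By <-]; exact: h.
Qed.

Lemma dist_toD (R : realType) (B : set 'rV[R]_2) (x y : 'rV[R]_2) :
  B !=set0 -> dist_to B x <= enorm (x - y) + dist_to B y.
Proof.
move=> B0; rewrite -lerBlDl; apply: dist_to_ge => // z Bz.
rewrite lerBlDl (le_trans (dist_to_le _ Bz))//.
by rewrite (le_trans _ (enormD _ _))// addrA subrK.
Qed.

Lemma dist_to_excess (R : realType) (A B : convex_curve R) (x : 'rV[R]_2) :
  curve_set A x -> dist_to B x <= excess A B.
Proof.
move=> Ax; apply: ub_le_sup; last by exists x.
have [M AM] := curve_bounded A; have [b Bb] := curve_nonempty B.
exists (M + enorm b) => _ [y Ay <-].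
rewrite (le_trans (dist_to_le _ Bb))// (le_trans (enormD _ _))//.
by rewrite enormN lerD2r AM.
Qed.

Lemma excess_le (R : realType) (A B : convex_curve R) (r : R) :
  (forall x, curve_set A x -> dist_to B x <= r) -> excess A B <= r.
Proof.
move=> h; have [a Aa] := curve_nonempty A.
by apply: ge_sup; [exists (dist_to B a); exists a|move=> _ [x Ax <-]; exact: h].
Qed.

Lemma excessD (R : realType) (B A C : convex_curve R) :
  excess A C <= excess A B + excess B C.
Proof.
apply: excess_le => x Ax.
rewrite -lerBlDr (le_trans _ (dist_to_excess B Ax))//.
apply: dist_to_ge; first exact: curve_nonempty.
move=> y By; rewrite lerBlDr (le_trans (dist_toD x y (curve_nonempty C)))//.
by rewrite lerD2l dist_to_excess.
Qed.

Lemma excess_ge0 (R : realType) (A B : convex_curve R) : 0 <= excess A B.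
Proof.
have [a Aa] := curve_nonempty A; rewrite (le_trans _ (dist_to_excess B Aa))//.
by apply: dist_to_ge => [|y _]; [exact: curve_nonempty|exact: enorm_ge0].
Qed.

Lemma excess_le0 (R : realType) (A B : convex_curve R) :
  excess A B <= 0 -> A `<=` B.
Proof.
move=> AB x Ax; apply: curve_closed.
move=> U /nbhs_ballP[e /= e0 eU].
have : dist_to B x < e by rewrite (le_lt_trans (dist_to_excess B Ax))// (le_lt_trans AB).
have [b Bb] := curve_nonempty B.
have i : [set enorm (x - y) | y in B] !=set0 by exists (enorm (x - b)), b.
move/(inf_lt i) => [_ [y By <-] xy].
exists y; split => //; apply: eU; rewrite -ball_normE/=.
exact: le_lt_trans (norm_le_enorm _) xy.
Qed.

Lemma curve_inj (R : realType) (A B : convex_curve R) :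
  A = B :> set 'rV[R]_2 -> A = B.
Proof.
case: A B => [A hA] [B hB] /= AB; rewrite AB in hA *.
by rewrite (Prop_irrelevance hA hB).
Qed.

Section hausdorff_metric.
Context {R : realType}.
Implicit Types A B C : convex_curve R.

Let hausdorff_distxx A : hausdorff_dist A A = 0.
Proof.
rewrite /hausdorff_dist maxxx; apply/eqP; rewrite eq_le excess_ge0 andbT.
by apply: excess_le => x Ax; rewrite (le_trans (dist_to_le x Ax))// subrr enorm0.
Qed.

Let hausdorff_dist_positivity A B : hausdorff_dist A B = 0 -> A = B.
Proof.
move=> h; apply/curve_inj/seteqP; split; apply: excess_le0;
  by rewrite -h /hausdorff_dist le_max lexx ?orbT.
Qed.

Let hausdorff_dist_sym A B : hausdorff_dist A B = hausdorff_dist B A.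
Proof. by rewrite /hausdorff_dist maxC. Qed.

Let hausdorff_dist_triangle B A C :
  hausdorff_dist A C <= hausdorff_dist A B + hausdorff_dist B C.
Proof.
rewrite /hausdorff_dist ge_max; apply/andP; split.
  by rewrite (le_trans (excessD B _ _))// lerD// le_max lexx.
by rewrite addrC (le_trans (excessD B _ _))// lerD// le_max lexx orbT.
Qed.

HB.instance Definition _ := gen_eqMixin (convex_curve R).
HB.instance Definition _ := gen_choiceMixin (convex_curve R).
HB.instance Definition _ := @isMetric.Build R (convex_curve R) _
  hausdorff_distxx hausdorff_dist_positivity hausdorff_dist_sym
  hausdorff_dist_triangle.

End hausdorff_metric.

(* Main.v *)
Require Import Defs.
From mathcomp Require Import all_boot all_order all_algebra.
From mathcomp Require Import all_classical all_reals all_analysis.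
From mathcomp Require Import ring lra.

(** Fix a direction n.  A pair (a, b) of points of C for which n . (a - b) is
    maximal ([max_pair] with error 0) is exactly a pair carrying parallel
    supporting lines with normal n, so [a, b] is an affine diameter.  The sign
    of det (p - a, b - a) tells on which side of such a chord the point p lies;
    [side s C p n] says that p lies on side s, with a margin, of every chord
    that is nearly maximal for n.  This is an open condition on (C, p, n) jointly,
    and passing from n to - n exchanges the two sides.  If p is on no side for n,
    then some affine diameter with normal n contains p: the maximal pairs for n
    form a convex set, because the supports of a body at n and - n are convex, so
    chords having p weakly on either side can be deformed into one through p
    ([chord_through]).  Hence whenever p is on different sides for two directions,
    there is an affine diameter through p for some direction in between
    ([side_ivt]).

    To get continuum many diameters through p it suffices that such sign changes
    branch: if p is on side s at one rational direction and on the other side at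
    a later one, then there are rational directions in between at which p is on
    the other side and then on side s again ([splits]).  An interval of directions
    with a sign change then contains two disjoint intervals with the same
    sign change, and iterating produces a binary tree whose branches
    are indexed by nat -> bool, each giving an affine diameter through p.
    Different branches give different segments: between their directions lies
    one for which p is strictly on one side of all maximal chords, whereas the
    normals for which a fixed pair is maximal form a convex cone
    ([separated_chords]).  Conversely a segment is determined by the rational
    boxes that it meets, so there are at most continuum many.

    It remains to see that the branching property is generic.  It consists of
    countably many conditions, each of which asks for an open set of points p, so
    it is enough that the failure of one of them throughout one rational box is a
    nowhere dense property of C ([stuck_nowhere_dense]), and for this that every
    C admits arbitrarily small perturbations satisfying the condition near a given
    point p0.  Here is the perturbation ([cross]).  An affine diameter
    [a, b] = [p0 + v, p0 - l v], with normal n0, passes through p0.  Choose q1 and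
    q2 close to (1 + eps) v, differing by a small vector orthogonal to n0, and
    replace the body by its convex hull with p0 + q1, p0 + q2, p0 - l q1,
    p0 - l q2.  These points stick out of the body, so directions slightly before
    n0 select the chord from p0 + q1 to p0 - l q1 only, and directions slightly
    after n0 the chord from p0 + q2 to p0 - l q2 only.  The two chords cross at
    p0, so a point p0 + t v with t small lies on different sides of them. *)

Set Implicit Arguments.
Unset Strict Implicit.
Unset Printing Implicit Defensive.

Import Order.TTheory GRing.Theory Num.Theory.
Import numFieldNormedType.Exports.

Local Open Scope classical_set_scope.
Local Open Scope card_scope.
Local Open Scope ring_scope.

(** * Plane geometry and convex bodies *)

Section plane.
Context {R : realType}.
Implicit Types (x y z v n p : 'rV[R]_2) (K T : set 'rV[R]_2)
  (C D : convex_curve R).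

Definition det2 x y : R := x 0 0 * y 0 1 - x 0 1 * y 0 0.

Definition perp x : 'rV[R]_2 := \row_i (if i == 0 then - x 0 1 else x 0 0).

Lemma dotDr n x y : dot n (x + y) = dot n x + dot n y.
Proof. by rewrite !dot2E !mxE; ring. Qed.

Lemma dotBr n x y : dot n (x - y) = dot n x - dot n y.
Proof. by rewrite !dot2E !mxE; ring. Qed.

Lemma dotZr n k x : dot n (k *: x) = k * dot n x.
Proof. by rewrite !dot2E !mxE; ring. Qed.

Lemma dotDl n m x : dot (n + m) x = dot n x + dot m x.
Proof. by rewrite !dot2E !mxE; ring. Qed.

Lemma dotZl n k x : dot (k *: n) x = k * dot n x.
Proof. by rewrite !dot2E !mxE; ring. Qed.

Lemma dotNl n x : dot (- n) x = - dot n x.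
Proof. by rewrite !dot2E !mxE; ring. Qed.

Lemma dot_perp n x : dot x (perp n) = det2 n x.
Proof. by rewrite dot2E /det2 !mxE /=; ring. Qed.

Lemma dot_gt0 n : n != 0 -> 0 < dot n n.
Proof.
move=> n0; rewrite dot2E lt_def addr_ge0 -?expr2 ?sqr_ge0// andbT.
apply: contra n0; rewrite paddr_eq0 ?sqr_ge0// !sqrf_eq0 => /andP[/eqP h0 /eqP h1].
apply/eqP/rowP => i; rewrite mxE; case: i => -[|[|//]] hi.
  by rewrite -[RHS]h0; congr (n _ _); exact/val_inj.
by rewrite -[RHS]h1; congr (n _ _); exact/val_inj.
Qed.

Lemma coord_le_norm x i : `|x 0 i| <= `|x|.
Proof.
rewrite {2}/Num.norm/= mx_normrE.
exact: (le_bigmax _ (fun ij => `|x ij.1 ij.2|) (0, i)).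
Qed.

Lemma norm_prodB_le x y i j : `|x 0 i * y 0 j| <= `|x| * `|y|.
Proof. by rewrite normrM ler_pM// coord_le_norm. Qed.

Lemma norm_dot_le x y : `|dot x y| <= 2 * (`|x| * `|y|).
Proof.
rewrite dot2E (le_trans (ler_normD _ _))//.
by have := norm_prodB_le x y 0 0; have := norm_prodB_le x y 1 1; lra.
Qed.

Lemma norm_det2_le x y : `|det2 x y| <= 2 * (`|x| * `|y|).
Proof.
rewrite /det2 (le_trans (ler_normB _ _))//.
by have := norm_prodB_le x y 0 1; have := norm_prodB_le x y 1 0; lra.
Qed.

Lemma convexP T : convex_set T <->
  forall x y t, T x -> T y -> 0 <= t <= 1 -> T ((1 - t) *: x + t *: y).
Proof.
split=> [cT x y t Tx Ty /andP[t0 t1]|h x y k /set_mem Tx /set_mem Ty].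
  pose k : {i01 R} := Itv01 t0 t1.
  have /set_mem := cT y x k (mem_set Ty) (mem_set Tx).
  by rewrite /conv /= /unstable.onem addrC.
apply/mem_set; have := h y x k%:num Ty Tx.
rewrite /conv /= /unstable.onem addrC; apply; apply/andP; split => //.
Qed.

Lemma body_compact C : compact (body C).
Proof. by have [[]] := body_spec C. Qed.

Lemma body_closed C : closed (body C).
Proof. apply: compact_closed; [exact: norm_hausdorff|exact: (@body_compact C)]. Qed.

Lemma body_convex C x y t :
  body C x -> body C y -> 0 <= t <= 1 -> body C ((1 - t) *: x + t *: y).
Proof. by have [[_ cK _] _] := body_spec C; move/convexP : cK; exact. Qed.

Lemma in_curveE C x : curve_set C x <-> body C x /\ ~ interior (body C) x.
Proof.
have [_ <-] := body_spec C; rewrite /boundary.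
have /closure_id <- := @body_closed C.
by split.
Qed.

Lemma curve_sub_body C x : curve_set C x -> body C x.
Proof. by move/in_curveE => []. Qed.

Lemma ray_curve C x v : body C x -> v != 0 ->
  exists2 t : R, 0 <= t & curve_set C (x + t *: v).
Proof.
move=> Kx v0; have [t t0 h] := ray_boundary (@body_compact C) Kx v0.
by exists t => //; have [_ <-] := body_spec C.
Qed.

Lemma body_bound C : exists2 M : R, 0 < M & forall x, body C x -> `|x| <= M.
Proof.
have [M [_ KM]] := compact_bounded (@body_compact C).
exists (`|M| + 1); first by rewrite ltr_pwDr.
by move=> x Kx; apply: (KM (`|M| + 1)) => //; rewrite ltr_pwDr// ler_norm.
Qed.

(** The ray from x in direction n leaves the body at a point of the curve
    where n . x is larger. *)
Lemma max_body C n c : n != 0 ->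
  (forall x, curve_set C x -> dot n x <= c) -> forall x, body C x -> dot n x <= c.
Proof.
move=> n0 h x Kx; have [t t0 /h] := ray_curve Kx n0.
apply: le_trans; rewrite dotDr dotZr lerDl mulr_ge0// ltW// dot_gt0//.
Qed.

(** A maximum of a linear form cannot be attained in the interior; otherwise
    the ray in direction n would increase it. *)
Lemma max_in_curve C n x : n != 0 -> body C x ->
  (forall y, curve_set C y -> dot n y <= dot n x) -> curve_set C x.
Proof.
move=> n0 Kx h; have [t t0 Ct] := ray_curve Kx n0.
move: (h _ Ct); rewrite dotDr dotZr gerDl pmulr_lle0 ?dot_gt0// => tle.
by move: Ct; rewrite (@le_anti _ _ t 0) ?t0 ?tle// scale0r addr0.
Qed.

Lemma interior_ball K p : interior K p <->
  exists2 r, 0 < r & forall z, `|z| < r -> K (p + z).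
Proof.
split=> [/nbhs_ballP[r /= r0 h]|[r r0 h]].
  exists r => // z zr; apply: h; rewrite -ball_normE /=.
  by rewrite opprD addNKr normrN.
apply/nbhs_ballP; exists r => //= z; rewrite -ball_normE /= => pz.
by rewrite -(subrKC p z); apply: h; rewrite distrC.
Qed.

Lemma dot_interior_lt C n p c : n != 0 -> interior (body C) p ->
  (forall x, curve_set C x -> dot n x <= c) -> dot n p < c.
Proof.
move=> n0 /interior_ball[r r0 h] nc.
have nn : 0 < `|n| by rewrite normr_gt0.
have : body C (p + (r / 2 / `|n|) *: n).
  apply: h; rewrite normrZ ger0_norm ?divr_ge0 ?ltW//.
  by rewrite divfK ?gt_eqF//; lra.
move=> /(max_body n0 nc); apply: lt_le_trans.
by rewrite dotDr dotZr ltrDl mulr_gt0 ?dot_gt0// !divr_gt0.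
Qed.

(** The homothetic image of a ball around p with centre x stays in the body. *)
Lemma interior_convex C p x t : interior (body C) p -> body C x ->
  0 <= t < 1 -> interior (body C) ((1 - t) *: p + t *: x).
Proof.
move=> /interior_ball[r r0 h] Kx /andP[t0 t1].
have t1' : 0 < 1 - t by rewrite subr_gt0.
apply/interior_ball; exists ((1 - t) * r); first exact: mulr_gt0.
move=> z zr; have -> : (1 - t) *: p + t *: x + z =
    (1 - t) *: (p + (1 - t)^-1 *: z) + t *: x.
  by rewrite scalerDr scalerA mulfV ?gt_eqF// scale1r addrAC.
apply: body_convex => //; last by rewrite t0 ltW.
by apply: h; rewrite normrZ gtr0_norm ?invr_gt0// mulrC ltr_pdivrMr// mulrC.
Qed.

Lemma hausdorff_near C D e x : hausdorff_dist C D < e -> curve_set C x ->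
  exists2 y, curve_set D y & `|x - y| < e.
Proof.
rewrite /hausdorff_dist gt_max => /andP[CD _] Cx.
have : dist_to D x < e by rewrite (le_lt_trans (dist_to_excess D Cx)).
have [b Db] := curve_nonempty D.
have i : [set enorm (x - y) | y in D] !=set0 by exists (enorm (x - b)), b.
move/(inf_lt i) => [_ [y Dy <-] xy].
by exists y => //; exact: le_lt_trans (norm_le_enorm _) xy.
Qed.

Lemma hausdorff_sym C D : hausdorff_dist C D = hausdorff_dist D C.
Proof. by rewrite /hausdorff_dist maxC. Qed.

(** The factor 2 pays for replacing the Euclidean norm by the sup norm. *)
Lemma hausdorff_le C D e :
  (forall x, curve_set C x -> exists2 y, curve_set D y & `|x - y| <= e) ->
  (forall x, curve_set D x -> exists2 y, curve_set C y & `|x - y| <= e) ->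
  hausdorff_dist C D <= 2 * e.
Proof.
move=> CD DC; rewrite /hausdorff_dist ge_max.
apply/andP; split; apply: excess_le => x; [move=> /CD|move=> /DC] => -[y Dy xy];
  by rewrite (le_trans (dist_to_le _ Dy))// (le_trans (enorm_le _))// ler_pM2l.
Qed.

End plane.

(** * The side of a point with respect to the extremal chords *)

Section sides.
Context {R : realType}.
Implicit Types (s : bool) (x y z v w n p a b : 'rV[R]_2)
  (C D : convex_curve R).

Lemma row2P x y : x 0 0 = y 0 0 -> x 0 1 = y 0 1 -> x = y.
Proof.
move=> h0 h1; apply/rowP => i; case: i => -[|[|//]] hi.
  by rewrite (_ : Ordinal hi = 0) //; exact: val_inj.
by rewrite (_ : Ordinal hi = 1) //; exact: val_inj.
Qed.

Lemma norm2_lt x d : `|x 0 0| < d -> `|x 0 1| < d -> `|x| < d.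
Proof.
move=> h0 h1; rewrite {1}/Num.norm/= mx_normrE; apply/bigmax_ltP; split.
  exact: le_lt_trans h0.
move=> [i j] _ /=; rewrite (ord1 i); case: j => -[|[|//]] hj.
  by rewrite (_ : Ordinal hj = 0) //; exact: val_inj.
by rewrite (_ : Ordinal hj = 1) //; exact: val_inj.
Qed.

Lemma det2_lipschitz x x' y y' :
  `|det2 x y - det2 x' y'| <= 2 * (`|x| * `|y - y'| + `|x - x'| * `|y'|).
Proof.
have -> : det2 x y - det2 x' y' = det2 x (y - y') + det2 (x - x') y'.
  by rewrite /det2 !mxE; ring.
by rewrite mulrDr (le_trans (ler_normD _ _))// lerD// norm_det2_le.
Qed.

Lemma sign_lipschitz s (t t' : R) : (-1) ^+ s * t <= (-1) ^+ s * t' + `|t - t'|.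
Proof.
have := ler_norm (t - t'); have := ler_norm (- (t - t')); rewrite normrN.
by case: s; rewrite ?expr0 ?expr1; lra.
Qed.

(** Pairs of points of C which maximise n . (a - b) up to e.  Allowing the
    error e makes the notions built on it stable under perturbation of C
    without any appeal to compactness. *)
Definition max_pair C n e a b := [/\ curve_set C a, curve_set C b &
  forall x y, curve_set C x -> curve_set C y ->
    dot n (x - y) <= dot n (a - b) + e].

(** The strict inequality is required with a uniform margin over nearly
    maximal pairs, so that openness in C, p and n is a direct estimate; the
    boolean s is the sign. *)
Definition side (s : bool) C p n := exists2 e : R, 0 < e &
  forall a b, max_pair C n e a b -> e <= (-1) ^+ s * det2 (p - a) (b - a).

Lemma max_pairN C n e a b : max_pair C n e a b -> max_pair C (- n) e b a.
Proof.
move=> [Ca Cb h]; split => // x y Cx Cy; have := h _ _ Cy Cx.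
by rewrite !dotNl !dotBr; lra.
Qed.

Lemma sideN s C p n : side s C p n -> side (~~ s) C p (- n).
Proof.
move=> [e e0 h]; exists e => // a b /max_pairN; rewrite opprK => /h.
by rewrite signrN; rewrite /det2 !mxE; lra.
Qed.

Lemma distB_lt x x' y y' (d : R) :
  `|x - x'| < d -> `|y - y'| < d -> `|(x - y) - (x' - y')| <= 2 * d.
Proof.
move=> xx yy; rewrite (_ : _ - _ = (x - x') - (y - y')).
  by rewrite (le_trans (ler_normB _ _))//; lra.
by rewrite !opprB addrACA [RHS]addrACA; congr (_ + _); rewrite addrC.
Qed.

Lemma normB_le2 x y (d : R) : `|x| <= d -> `|y| <= d -> `|x - y| <= 2 * d.
Proof. by move=> xx yy; rewrite (le_trans (ler_normB _ _))//; lra. Qed.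

Lemma near_norm_le x y (M d : R) : `|x - y| < d -> `|x| <= M -> `|y| <= M + d.
Proof.
move=> xy xM; rewrite -[y](subKr x) (le_trans (ler_normB _ _))//.
by rewrite lerD// ltW.
Qed.

(** Replacing C, n and the points by nearby ones changes n . (x - y) by at
    most a multiple of the distance, uniformly because C is bounded. *)
Lemma max_pair_near C n e : 0 < e -> exists2 d, 0 < d &
  forall D n' a b a' b', hausdorff_dist C D < d -> `|n - n'| < d ->
    curve_set C a -> curve_set C b -> `|a - a'| < d -> `|b - b'| < d ->
    max_pair D n' (e / 2) a' b' -> max_pair C n e a b.
Proof.
move=> e0; have [M M0 CM] := body_bound C.
(* B bounds n, the points of C and the points of D near them *)
pose B := 1 + `|n| + M; have B0 : 0 < B by rewrite /B; have := normr_ge0 n; lra.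
exists (Num.min 1 (e / (32 * B))); first by rewrite lt_min ltr01 divr_gt0// mulr_gt0.
set d := Num.min _ _.
have d1 : d <= 1 by rewrite /d ge_min lexx.
have dB : d * B <= e / 32.
  rewrite -ler_pdivlMr// -mulrA -invfM; by rewrite /d ge_min lexx orbT.
move=> D n' a b a' b' CD nn Ca Cb aa bb [Da' Db' h].
have nearB (x x' : 'rV[R]_2) : curve_set C x -> `|x - x'| < d -> `|x'| <= B.
  move=> Cx xx; apply: le_trans (near_norm_le xx (CM _ (curve_sub_body Cx))) _.
  by rewrite /B; have := normr_ge0 n; lra.
have key x y x' y' : curve_set C x -> curve_set C y ->
    `|x - x'| < d -> `|y - y'| < d ->
    `|dot n (x - y) - dot n' (x' - y')| <= e / 4.
  move=> Cx Cy xx yy.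
  have h1 := distB_lt xx yy.
  have h2 := normB_le2 (nearB _ _ Cx xx) (nearB _ _ Cy yy).
  have nB : `|n| <= B by rewrite /B; lra.
  rewrite (_ : _ - _ = dot n (x - y - (x' - y')) + dot (n - n') (x' - y')); last first.
    by rewrite !dot2E !mxE; ring.
  apply: le_trans (ler_normD _ _) _.
  have := norm_dot_le n (x - y - (x' - y')).
  have := norm_dot_le (n - n') (x' - y').
  have := ler_pM (normr_ge0 _) (normr_ge0 _) nB h1.
  have := ler_pM (normr_ge0 _) (normr_ge0 _) (ltW nn) h2.
  move: dB; lra.
split => // x y Cx Cy.
have [x' Dx' xx] := hausdorff_near CD Cx.
have [y' Dy' yy] := hausdorff_near CD Cy.
have := h _ _ Dx' Dy'.
have /ler_normlP[_ k1] := key _ _ _ _ Cx Cy xx yy.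
have /ler_normlP[k2 _] := key _ _ _ _ Ca Cb aa bb.
lra.
Qed.

Lemma det2_near C p e : 0 < e -> exists2 d, 0 < d &
  forall p' a b a' b', curve_set C a -> curve_set C b ->
    `|p - p'| < d -> `|a - a'| < d -> `|b - b'| < d ->
    `|det2 (p - a) (b - a) - det2 (p' - a') (b' - a')| <= e.
Proof.
move=> e0; have [M M0 CM] := body_bound C.
pose B := 1 + `|p| + M; have B0 : 0 < B by rewrite /B; have := normr_ge0 p; lra.
exists (Num.min 1 (e / (16 * B))); first by rewrite lt_min ltr01 divr_gt0// mulr_gt0.
set d := Num.min _ _.
have d1 : d <= 1 by rewrite /d ge_min lexx.
have dB : d * B <= e / 16.
  by rewrite -ler_pdivlMr// -mulrA -invfM /d ge_min lexx orbT.
move=> p' a b a' b' Ca Cb pp aa bb.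
have pB : `|p| <= B by rewrite /B; lra.
have CB x : curve_set C x -> `|x| <= B.
  by move=> /curve_sub_body/CM; rewrite /B; have := normr_ge0 p; lra.
have nearB x x' : curve_set C x -> `|x - x'| < d -> `|x'| <= B.
  move=> /curve_sub_body/CM xM xx; apply: le_trans (near_norm_le xx xM) _.
  by rewrite /B; have := normr_ge0 p; lra.
have k1 := distB_lt pp aa; have k2 := distB_lt bb aa.
have k3 := normB_le2 pB (CB _ Ca).
have k4 := normB_le2 (nearB _ _ Cb bb) (nearB _ _ Ca aa).
have := ler_pM (normr_ge0 _) (normr_ge0 _) k3 k2.
have := ler_pM (normr_ge0 _) (normr_ge0 _) k1 k4.
have := det2_lipschitz (p - a) (p' - a') (b - a) (b' - a').
by move: dB; lra.
Qed.

Lemma side_open s C p n : side s C p n -> exists2 d, 0 < d &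
  forall D p' n', hausdorff_dist C D < d -> `|p - p'| < d -> `|n - n'| < d ->
    side s D p' n'.
Proof.
move=> [e e0 h]; have e20 : 0 < e / 2 by rewrite divr_gt0.
have [d1 d10 hd1] := max_pair_near C n e0.
have [d2 d20 hd2] := det2_near C p e20.
exists (Num.min d1 d2); first by rewrite lt_min d10.
move=> D p' n'; rewrite !lt_min => /andP[CD1 CD2] /andP[pp1 pp2] /andP[nn1 nn2].
exists (e / 2) => // a' b' ab'; have [Da' Db' _] := ab'.
have DC : hausdorff_dist D C < Num.min d1 d2 by rewrite hausdorff_sym lt_min CD1.
have [a Ca] := hausdorff_near DC Da'; have [b Cb] := hausdorff_near DC Db'.
rewrite !lt_min distrC => /andP[bb1 bb2]; rewrite distrC => /andP[aa1 aa2].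
have /h : max_pair C n e a b by exact: hd1 ab'.
have := hd2 _ _ _ _ _ Ca Cb pp2 aa2 bb2.
have := sign_lipschitz s (det2 (p - a) (b - a)) (det2 (p' - a') (b' - a')); lra.
Qed.

(** If p is not on side s, there are pairs with smaller and smaller error
    which have p almost on the opposite side; by compactness of C they
    accumulate at a maximal pair. *)
Lemma not_side_pair s C p n : ~ side s C p n ->
  exists a b, max_pair C n 0 a b /\ (-1) ^+ s * det2 (p - a) (b - a) <= 0.
Proof.
move=> ns.
pose G (e : R) := [set ab : 'rV[R]_2 * 'rV[R]_2 |
  max_pair C n e ab.1 ab.2 /\ (-1) ^+ s * det2 (p - ab.1) (ab.2 - ab.1) < e].
have G0 e : 0 < e -> G e !=set0.
  move=> e0; apply: contrapT => h; apply: ns; exists e => // a b ab.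
  by rewrite leNgt; apply/negP => lt; apply: h; exists (a, b).
have GS e e' : e <= e' -> G e `<=` G e'.
  move=> ee [a b] [[/= Ca Cb h] lt]; split; last exact: lt_le_trans ee.
  by split => // x y Cx Cy; rewrite (le_trans (h _ _ Cx Cy))// lerD2l.
pose F := filter_from [set e : R | 0 < e] G.
have PF : ProperFilter F.
  apply: filter_from_proper; last exact: G0.
  apply: filter_from_filter; first by exists 1 => /=.
  move=> i j /= i0 j0; exists (Num.min i j); first by rewrite /= lt_min i0.
  by move=> ab Gab; split; apply: GS Gab; rewrite ge_min lexx ?orbT.
have cC : compact (curve_set C).
  apply: subclosed_compact (@body_compact R C) _; first exact: curve_closed.
  exact: curve_sub_body.
have FC : F (curve_set C `*` curve_set C).
  by exists 1 => //= -[a b] [[Ca Cb _] _].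
have [[a b] [[/= Ca Cb] cl]] := compact_setX cC cC PF FC.
have dist0 : hausdorff_dist C C = 0 by exact: (@mdistxx R (convex_curve R)).
have near (e d : R) : 0 < e -> 0 < d ->
    exists a' b', [/\ G e (a', b'), `|a - a'| < d & `|b - b'| < d].
  move=> e0 d0; have [[a' b'] [Ge [/= aa bb]]] : G e `&` ball (a, b) d !=set0.
    by apply: cl; [exists e|exact: nbhsx_ballx].
  rewrite -ball_normE/= in aa; rewrite -ball_normE/= in bb.
  by exists a', b'.
exists a, b; split.
  split => // x y Cx Cy; rewrite addr0; apply/ler_addgt0Pr => e e0.
  have [d d0 hd] := max_pair_near C n e0.
  have e20 : 0 < e / 2 by rewrite divr_gt0.
  have [a' [b' [[/= ab' _] aa bb]]] := near _ _ e20 d0.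
  have [_ _] : max_pair C n e a b.
    by apply: hd ab' => //; rewrite ?dist0 ?subrr ?normr0.
  exact.
apply/ler_addgt0Pr => e e0; rewrite add0r.
have e20 : 0 < e / 2 by rewrite divr_gt0.
have [d d0 hd] := det2_near C p e20.
have [a' [b' [[/= _ lt] aa bb]]] := near _ _ e20 d0.
have pp : `|p - p| < d by rewrite subrr normr0.
have := hd _ _ _ _ _ Ca Cb pp aa bb; move: lt.
have := sign_lipschitz s (det2 (p - a) (b - a)) (det2 (p - a') (b' - a')); lra.
Qed.

End sides.

(** * Extremal chords through a point *)

Section chords.
Context {R : realType}.
Implicit Types (x y z v w n p a b : 'rV[R]_2) (C D : convex_curve R).

(** Maximality of the difference decouples: a maximises and b minimises n. *)
Lemma max_pairP C n a b : max_pair C n 0 a b <->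
  [/\ curve_set C a, curve_set C b, (forall x, curve_set C x -> dot n x <= dot n a) &
      (forall x, curve_set C x -> dot n b <= dot n x)].
Proof.
split=> [[Ca Cb h]|[Ca Cb ha hb]]; split => // x.
- by move=> Cx; have := h _ _ Cx Cb; rewrite !dotBr; lra.
- by move=> Cx; have := h _ _ Ca Cx; rewrite !dotBr; lra.
- by move=> y Cx Cy; have := ha _ Cx; have := hb _ Cy; rewrite !dotBr; lra.
Qed.

Lemma max_pair0_le C n e a b : 0 <= e -> max_pair C n 0 a b -> max_pair C n e a b.
Proof.
move=> e0 [Ca Cb h]; split => // x y Cx Cy.
by have := h _ _ Cx Cy; lra.
Qed.

Lemma side_max_pair s C p n a b : side s C p n -> max_pair C n 0 a b ->
  0 < (-1) ^+ s * det2 (p - a) (b - a).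
Proof.
move=> [e e0 h] ab; apply: lt_le_trans (e0) _; apply: h.
by apply: max_pair0_le ab; exact: ltW.
Qed.

Lemma max_pair_lt C n a b : n != 0 -> max_pair C n 0 a b -> dot n b < dot n a.
Proof.
move=> n0 /max_pairP[Ca Cb ha hb].
have [[_ _ [q iq]] _] := body_spec C.
have qa := dot_interior_lt n0 iq ha.
apply: le_lt_trans qa; rewrite -lerN2 -!dotNl.
have n0' : - n != 0 by rewrite oppr_eq0.
apply: (max_body n0'); last exact: (interior_subset iq).
by move=> x Cx; rewrite !dotNl lerN2 hb.
Qed.

Lemma parallel_of_det2 n w v : det2 w v = 0 -> dot n v *: w = dot n w *: v.
Proof.
move=> h; apply: row2P; apply/eqP; rewrite -subr_eq0; apply/eqP.
  transitivity (n 0 1 * det2 w v); last by rewrite h mulr0.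
  by rewrite !dot2E !mxE /det2; ring.
transitivity (- n 0 0 * det2 w v); last by rewrite h mulr0.
by rewrite !dot2E !mxE /det2; ring.
Qed.

Lemma quadratic_ivt (c0 c1 c2 : R) : c0 <= 0 <= c0 + c1 + c2 ->
  exists2 t, 0 <= t <= 1 & c0 + c1 * t + c2 * t ^+ 2 = 0.
Proof.
move=> h; pose q : {poly R} := c0%:P + c1%:P * 'X + c2%:P * 'X^2.
have hq t : q.[t] = c0 + c1 * t + c2 * t ^+ 2 by rewrite /q !hornerE.
have [||t t01 /rootP] := @poly_ivt R q 0 1; first exact: ler01.
  by rewrite !hq !expr2 !mulr0 !mulr1 !addr0.
by rewrite hq => qt; exists t.
Qed.

(** The maximisers of n on the body form a face, and so do the minimisers. *)
Lemma max_pair_convex C n a b a' b' t : n != 0 -> 0 <= t <= 1 ->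
  max_pair C n 0 a b -> max_pair C n 0 a' b' ->
  max_pair C n 0 ((1 - t) *: a + t *: a') ((1 - t) *: b + t *: b').
Proof.
move=> n0 t01 /max_pairP[Ca Cb ha hb] /max_pairP[Ca' Cb' ha' hb'].
have aa : dot n a' = dot n a by apply/eqP; rewrite eq_le ha// ha'.
have bb : dot n b' = dot n b by apply/eqP; rewrite eq_le hb// hb'.
have na : dot n ((1 - t) *: a + t *: a') = dot n a by rewrite dotDr !dotZr aa; ring.
have nb : dot n ((1 - t) *: b + t *: b') = dot n b by rewrite dotDr !dotZr bb; ring.
apply/max_pairP; split; rewrite ?na ?nb//.
  apply: (max_in_curve n0) => [|x Cx]; last by rewrite na ha.
  by apply: body_convex => //; exact: curve_sub_body.
have n0' : - n != 0 by rewrite oppr_eq0.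
apply: (max_in_curve n0') => [|x Cx]; last by rewrite !dotNl nb lerN2 hb.
by apply: body_convex => //; exact: curve_sub_body.
Qed.

(** A point of the body on the line through a and b lies between them, because
    it lies between the two supporting lines. *)
Lemma chord_of_det2 C n p a b : n != 0 -> body C p -> max_pair C n 0 a b ->
  det2 (p - a) (b - a) = 0 -> segment a b p.
Proof.
move=> n0 Kp ab d0; have lt := max_pair_lt n0 ab.
have /max_pairP[Ca Cb ha hb] := ab.
have pa : dot n p <= dot n a by apply: (max_body n0) Kp.
have bp : dot n b <= dot n p.
  rewrite -lerN2 -!dotNl; have n0' : - n != 0 by rewrite oppr_eq0.
  by apply: (max_body n0') Kp => x Cx; rewrite !dotNl lerN2 hb.
have := parallel_of_det2 n d0; rewrite !dotBr => h.
have l0 : dot n b - dot n a != 0 by rewrite lt_eqF// subr_lt0.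
set t := (dot n p - dot n a) / (dot n b - dot n a).
have ht : t *: (b - a) = p - a by rewrite /t mulrC -scalerA -h scalerK.
exists t => /=; rewrite /t.
  rewrite in_itv/= ler_ndivlMr ?ler_ndivrMr ?subr_lt0// mul0r mul1r.
  by apply/andP; split; lra.
rewrite -/t (_ : _ + _ = a + t *: (b - a)); first by rewrite ht addrC subrK.
by rewrite scalerBl scale1r scalerBr addrAC addrA.
Qed.

(** Not being on either side gives one maximal pair with p weakly on the left
    and another with p weakly on the right.  Interpolating linearly between
    them stays within maximal pairs and changes the determinant quadratically. *)
Lemma chord_through C n p : n != 0 -> body C p ->
  (forall s, ~ side s C p n) ->
  exists a b, max_pair C n 0 a b /\ det2 (p - a) (b - a) = 0.
Proof.
move=> n0 Kp ns.
have [a [b [ab]]] := not_side_pair (ns false); rewrite expr0 mul1r => le0.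
have [a' [b' [ab']]] := not_side_pair (ns true); rewrite expr1 mulN1r oppr_le0 => ge0.
pose u := a' - a; pose v := (b' - b) - u.
pose c1 := det2 (p - a) v - det2 u (b - a); pose c2 := - det2 u v.
have E t : det2 (p - ((1 - t) *: a + t *: a'))
    (((1 - t) *: b + t *: b') - ((1 - t) *: a + t *: a')) =
    det2 (p - a) (b - a) + c1 * t + c2 * t ^+ 2.
  by rewrite /c1 /c2 /v /u /det2 !mxE; ring.
have [|t t01 h] := @quadratic_ivt (det2 (p - a) (b - a)) c1 c2.
  rewrite le0/=; have := E 1; rewrite subrr !scale0r !scale1r !add0r => E1.
  by have := E1; rewrite expr1n !mulr1 => <-.
exists ((1 - t) *: a + t *: a'), ((1 - t) *: b + t *: b'); split.
  exact: max_pair_convex.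
by rewrite E.
Qed.

Lemma max_pair_exists C n e : 0 < e -> exists a b, max_pair C n e a b.
Proof.
move=> e0; have [c Cc] := curve_nonempty C; have [M M0 CM] := body_bound C.
pose S := [set dot n (xy.1 - xy.2) | xy in curve_set C `*` curve_set C].
have hS : has_sup S.
  split; first by exists (dot n (c - c)), (c, c).
  exists (2 * (`|n| * (2 * M))) => _ [[x y] [/= Cx Cy] <-].
  rewrite (le_trans (ler_norm _))// (le_trans (norm_dot_le _ _))//.
  by rewrite ler_pM2l// ler_wpM2l// normB_le2// CM//; exact: curve_sub_body.
have [_ [[a b] [/= Ca Cb] <-] lt] := sup_adherent e0 hS.
exists a, b; split => // x y Cx Cy; rewrite -lerBlDr (le_trans _ (ltW lt))// lerD2r.
by apply: ub_le_sup; [case: hS|exists (x, y)].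
Qed.

(** Some nearly maximal pair exists, and p cannot be on both sides of that
    chord. *)
Lemma side_excl s C p n : side s C p n -> side (~~ s) C p n -> False.
Proof.
move=> [e e0 h] [e' e'0 h'].
have m0 : 0 < Num.min e e' by rewrite lt_min e0.
have [a [b [Ca Cb ab]]] := max_pair_exists C n m0.
have /h : max_pair C n e a b.
  by split => // x y Cx Cy; rewrite (le_trans (ab _ _ Cx Cy))// lerD2l ge_min lexx.
have /h' : max_pair C n e' a b.
  by split => // x y Cx Cy; rewrite (le_trans (ab _ _ Cx Cy))// lerD2l ge_min lexx orbT.
by rewrite signrN mulNr; lra.
Qed.

(** A polynomial half-circle from - e_2 to e_2, for -1 <= s <= 1, passing
    through rational directions at rational parameters; [det2_dir] shows that
    it turns monotonically. *)
Definition dir (s : R) : 'rV[R]_2 := \row_i (if i == 0 then 1 - s ^+ 2 else s).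

Lemma det2_dir s t : det2 (dir s) (dir t) = (t - s) * (1 + s * t).
Proof. by rewrite /det2 !mxE /=; ring. Qed.

Lemma dir_neq0 s : dir s != 0.
Proof.
apply/eqP => /rowP h; have := h 0; have := h 1; rewrite !mxE /= => -> /eqP.
by rewrite expr0n subr0 oner_eq0.
Qed.

Lemma dirN1 : dir (-1) = - dir 1.
Proof. by apply: row2P; rewrite !mxE /=; ring. Qed.

Lemma dir_near s d : 0 < d -> exists2 e, 0 < e &
  forall t, `|s - t| < e -> `|dir s - dir t| < d.
Proof.
move=> d0; pose B := 2 * `|s| + 2.
have B0 : 0 < B by rewrite /B; have := normr_ge0 s; lra.
exists (Num.min 1 (d / B)) => [|t]; first by rewrite lt_min ltr01 divr_gt0.
rewrite lt_min => /andP[st1]; rewrite ltr_pdivlMr// => st.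
have B1 : 1 <= B by rewrite /B; have := normr_ge0 s; lra.
apply: norm2_lt; rewrite !mxE /=.
  rewrite (_ : _ - _ = (s - t) * - (s + t)); last by ring.
  rewrite normrM normrN; apply: le_lt_trans st; rewrite ler_wpM2l//.
  rewrite (_ : s + t = 2 * s - (s - t)); last by ring.
  rewrite (le_trans (ler_normB _ _))// normrM ger0_norm// /B; lra.
by apply: le_lt_trans st; rewrite ler_peMr.
Qed.

Lemma side_dir_open s C p r : side s C p (dir r) -> exists2 e, 0 < e &
  forall t, `|r - t| < e -> side s C p (dir t).
Proof.
move=> /side_open[d d0 hd]; have [e e0 he] := dir_near r d0.
exists e => // t st; apply: hd; [|by rewrite subrr normr0|exact: he].
by rewrite (_ : hausdorff_dist C C = 0)//; exact: (@mdistxx R (convex_curve R)).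
Qed.

(** The direction is the supremum of those at which p is on side s: openness
    of both sides excludes either of them at the supremum. *)
Lemma side_ivt s C p al be : al <= be ->
  ~ side (~~ s) C p (dir al) -> ~ side s C p (dir be) ->
  exists2 r, al <= r <= be & forall s', ~ side s' C p (dir r).
Proof.
move=> ab nal nbe; pose S := [set t | al <= t <= be /\ side s C p (dir t)].
have both r : ~ side s C p (dir r) -> ~ side (~~ s) C p (dir r) ->
    forall s', ~ side s' C p (dir r).
  by move: s {nal nbe S} => [] h1 h2 [].
have [[t0 St0]|S0] := pselect (S !=set0); last first.
  exists al; first by rewrite lexx.
  by apply: both => // sal; apply: S0; exists al; split; rewrite ?lexx.
have ubS : ubound S be by move=> t [/andP[]].
have hS : has_ubound S by exists be.
have s1 : al <= sup S.
  by have [/andP[h _] _] := St0; apply: le_trans h _; exact: ub_le_sup.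
have s2 : sup S <= be by apply: ge_sup => //; exists t0.
exists (sup S); first by rewrite s1.
apply: both => /side_dir_open[e e0 he].
  have [E|ne] := eqVneq (sup S) be.
    by apply: nbe; rewrite -E; apply: he; rewrite subrr normr0.
  have lt : sup S < be by rewrite lt_neqAle ne.
  pose t := Num.min be (sup S + e / 2).
  have tgt : sup S < t by rewrite lt_min lt ltrDl divr_gt0.
  have : S t.
    split; first by rewrite (le_trans s1 (ltW tgt)) ge_min lexx.
    apply: he; rewrite distrC gtr0_norm ?subr_gt0// ltrBlDl gt_min.
    by apply/orP; right; lra.
  by move/(ub_le_sup hS); rewrite leNgt tgt.
have [t St lt] := sup_adherent e0 (conj (ex_intro _ _ St0) hS).
have tle : t <= sup S by exact: ub_le_sup.
have [_ st] := St; apply: (side_excl st); apply: he.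
by rewrite ger0_norm ?subr_ge0//; lra.
Qed.

End chords.

(** * Adding points to a convex body *)

Section hulls.
Context {R : realType}.
Implicit Types (x y z v w n p a b q : 'rV[R]_2)
  (C D : convex_curve R) (K T : set 'rV[R]_2).

(** The convex hull of the convex set K and the point x. *)
Definition cone_over K x := [set (1 - yt.2) *: yt.1 + yt.2 *: x |
  yt in K `*` [set` `[(0:R), 1]]].

Lemma cone_over_sub K x : K `<=` cone_over K x.
Proof.
move=> y Ky; exists (y, 0) => /=; last by rewrite subr0 scale1r scale0r addr0.
by split => //=; rewrite in_itv/= lexx ler01.
Qed.

Lemma cone_over_apex K x : K !=set0 -> cone_over K x x.
Proof.
move=> [y Ky]; exists (y, 1) => /=; last by rewrite subrr scale1r scale0r add0r.
by split => //=; rewrite in_itv/= lexx ler01.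
Qed.

Lemma cone_over_min K x T : convex_set T -> K `<=` T -> T x -> cone_over K x `<=` T.
Proof.
move=> /convexP cT KT Tx _ [[y t] [/= Ky t01] <-]; by apply: cT => //; exact: KT.
Qed.

Lemma cone_over_compact K x : compact K -> compact (cone_over K x).
Proof.
move=> cK; apply: continuous_compact; last first.
  by apply: compact_setX => //; exact: segment_compact.
apply: continuous_subspaceT => -[y t]; apply: cvgD; apply: cvgZ.
- by apply: cvgB; [exact: cvg_cst|exact: cvg_snd].
- exact: cvg_fst.
- exact: cvg_snd.
- exact: cvg_cst.
Qed.

Lemma cone_over_convex K x : convex_set K -> convex_set (cone_over K x).
Proof.
move=> /convexP cK; apply/convexP => _ _ r [[y t] [/= Ky +] <-] [[y' t'] [/= Ky' +] <-].
rewrite !in_itv/= => /andP[t0 t1] /andP[t'0 t'1] /andP[r0 r1].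
pose u := (1 - r) * t + r * t'; pose w := r * (1 - t').
have w0 : 0 <= w by rewrite mulr_ge0// subr_ge0.
have w0' : 0 <= (1 - r) * (1 - t) by rewrite mulr_ge0// subr_ge0.
have uw : 1 - u = (1 - r) * (1 - t) + w by rewrite /u /w; ring.
have u0 : 0 <= u by rewrite addr_ge0 ?mulr_ge0// subr_ge0.
have [u1|u1] := eqVneq (1 - u) 0.
  have wz : w = 0 by lra.
  have wz' : (1 - r) * (1 - t) = 0 by lra.
  exists (y, u) => /=; first by split => //=; rewrite in_itv/= u0; lra.
  rewrite u1 scale0r add0r !scalerDr !scalerA wz' -/w wz !scale0r !add0r.
  by rewrite -scalerDl.
have u1p : 0 < 1 - u by rewrite lt_def u1/= uw addr_ge0.
exists ((1 - w / (1 - u)) *: y + (w / (1 - u)) *: y', u) => /=.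
  split => /=; last by rewrite in_itv/= u0; lra.
  apply: cK => //; rewrite divr_ge0 ?(ltW u1p)//= ler_pdivrMr// mul1r; lra.
rewrite !scalerDr !scalerA [(1 - u) * (w / _)]mulrC divfK//.
have -> : (1 - u) * (1 - w / (1 - u)) = (1 - r) * (1 - t).
  by rewrite mulrBr mulr1 [(1 - u) * (w / _)]mulrC divfK//; lra.
rewrite -!addrA; congr (_ + _); rewrite [RHS]addrCA; congr (_ + _).
by rewrite -scalerDl.
Qed.

Lemma cone_over_body K x : convex_body K -> convex_body (cone_over K x).
Proof.
move=> [cK vK [y Ky]]; split; [exact: cone_over_compact|exact: cone_over_convex|].
by exists y; apply: interiorS Ky; exact: cone_over_sub.
Qed.

Lemma curve_of_body K : convex_body K -> exists C, body C = K.
Proof.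
move=> bK; exists (ConvexCurve (ex_intro2 _ _ K bK erefl)).
by apply/esym/body_unique.
Qed.

(** The hull is described by its minimality among convex sets, which makes the
    order in which the points are added irrelevant. *)
Lemma hull_exists C (xs : seq 'rV[R]_2) : exists D,
  [/\ body C `<=` body D, (forall x, x \in xs -> body D x) &
   forall T, convex_set T -> body C `<=` T -> (forall x, x \in xs -> T x) ->
     body D `<=` T].
Proof.
elim: xs => [|x xs [D [CD xD minD]]]; first by exists C; split.
have [bD _] := body_spec D; have [E EE] := curve_of_body (cone_over_body x bD).
exists E; rewrite EE; split.
- by move=> y /CD; exact: cone_over_sub.
- move=> y; rewrite inE => /orP[/eqP ->|/xD]; last exact: cone_over_sub.
  by apply: cone_over_apex; have [_ _ [z /interior_subset]] := bD; exists z.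
- move=> T cT KT xT; apply: cone_over_min => //.
    by apply: minD => // y yx; apply: xT; rewrite inE yx orbT.
  by apply: xT; rewrite inE eqxx.
Qed.

(** Moving from a point of the body towards an interior point leads into the
    interior. *)
Lemma interior_shrink C p v k : interior (body C) p -> body C (p + k *: v) -> 1 < k ->
  interior (body C) (p + v).
Proof.
move=> ip Kk k1; have k0 : 0 < k by rewrite (lt_trans ltr01).
have -> : p + v = (1 - k^-1) *: p + k^-1 *: (p + k *: v).
  rewrite scalerDr scalerA mulVf ?gt_eqF// scale1r addrA -scalerDl.
  by rewrite subrK scale1r.
by apply: interior_convex => //; rewrite invr_ge0 ltW//= invf_lt1.
Qed.

(** Rays from the interior point p meet each of the two curves once, and the
    two intersections differ by a factor at most 1 + k. *)
Lemma hausdorff_homothety C D p k M : interior (body C) p -> 0 < k ->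
  body C `<=` body D ->
  (forall x, body D x -> body C (p + (1 + k)^-1 *: (x - p))) ->
  (forall x, body D x -> `|x - p| <= M) ->
  hausdorff_dist C D <= 2 * (k * M).
Proof.
move=> ip k0 CD DC DM; have k1 : 0 < 1 + k by rewrite addr_gt0.
apply: hausdorff_le => x.
  move/in_curveE => [Kx nix]; have v0 : x - p != 0.
    by apply/eqP => /eqP; rewrite subr_eq0 => /eqP xp; apply: nix; rewrite xp.
  have [t t0 Dt] := ray_curve (CD _ Kx) v0; exists (x + t *: (x - p)) => //.
  have tk : t <= k.
    rewrite leNgt; apply/negP => kt; apply: nix; rewrite -(subrKC p x).
    apply: (@interior_shrink _ _ _ ((1 + k)^-1 * (1 + t))) => //.
      have := DC _ (curve_sub_body Dt); congr (body C (_ + _)).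
      rewrite -scalerA; congr (_ *: _).
      by rewrite addrAC scalerDl scale1r.
    by rewrite mulrC ltr_pdivlMr// mul1r ltrD2l.
  by rewrite opprD addNKr normrN normrZ ger0_norm// ler_pM// DM//; exact: CD.
move=> Dx; have [Kx nix] := (in_curveE D x).1 Dx.
have v0 : x - p != 0.
  apply/eqP => /eqP; rewrite subr_eq0 => /eqP xp; apply: nix; rewrite xp.
  exact: (interiorS CD).
have [t t0 Ct] := ray_curve (DC _ Kx) v0.
exists (p + (1 + k)^-1 *: (x - p) + t *: (x - p)) => //.
rewrite -addrA -scalerDl in Ct *; set c := _ + t in Ct *.
have c1 : c <= 1.
  rewrite leNgt; apply/negP => c1; apply: nix; apply: (interiorS CD).
  by rewrite -(subrKC p x); apply: interior_shrink c1 => //; exact: curve_sub_body.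
rewrite opprD addrA -{1}(scale1r (x - p)) -scalerBl normrZ ger0_norm ?subr_ge0//.
rewrite ler_pM// ?subr_ge0//; last exact: DM.
have : (1 + k)^-1 <= c by rewrite /c lerDl.
have : 1 - k <= (1 + k)^-1.
  by rewrite -[leRHS]mul1r ler_pdivlMr//; have := sqr_ge0 k; lra.
lra.
Qed.

Lemma convex_homothety C p k : 
  convex_set [set x | body C (p + k *: (x - p))].
Proof.
apply/convexP => x y t /= Kx Ky t01; have := body_convex Kx Ky t01.
congr (body C _); apply: row2P; rewrite !mxE; ring.
Qed.

(** The point is a convex combination of p + v and of p + z / k, which is in
    the ball around p. *)
Lemma in_homothety C p v z k r : (forall z, `|z| < r -> body C (p + z)) ->
  0 < k -> body C (p + v) -> `|z| < k * r -> body C (p + (1 + k)^-1 *: (v + z)).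
Proof.
move=> h k0 Kv zr; have k1 : 0 < 1 + k by rewrite addr_gt0.
have -> : p + (1 + k)^-1 *: (v + z) =
    (1 - k / (1 + k)) *: (p + v) + (k / (1 + k)) *: (p + k^-1 *: z).
  apply: row2P; rewrite !mxE; field; rewrite ?gt_eqF//.
apply: body_convex => //.
  by apply: h; rewrite normrZ gtr0_norm ?invr_gt0// mulrC ltr_pdivrMr// mulrC.
rewrite divr_ge0 ?(ltW k0) ?(ltW k1)//= ler_pdivrMr// mul1r; lra.
Qed.

(** Points close to p + v and p - l v lie in a slightly enlarged homothetic
    copy of the body with centre p, hence so does the hull, whatever these
    points are.  The bound d is uniform, so that q1 and q2 may be chosen
    afterwards. *)
Lemma perturb C p v (l e : R) : interior (body C) p -> 0 < l -> 0 < e ->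
  body C (p + v) -> body C (p - l *: v) -> exists2 d, 0 < d &
  forall q1 q2, `|q1 - v| < d -> `|q2 - v| < d -> exists D,
    let xs := [:: p + q1; p + q2; p - l *: q1; p - l *: q2] in
    [/\ hausdorff_dist C D < e, (forall x, x \in xs -> body D x) &
     forall T, convex_set T -> body C `<=` T -> (forall x, x \in xs -> T x) ->
       body D `<=` T].
Proof.
move=> ip l0 e0 Kv Klv.
have [r r0 hr] := (interior_ball _ _).1 ip; have [M M0 CM] := body_bound C.
(* the hull lies within distance 4 M of p, see [hausdorff_homothety] *)
pose k := Num.min 1 (e / (16 * M)).
have k0 : 0 < k by rewrite lt_min ltr01 divr_gt0// mulr_gt0.
have k1 : k <= 1 by rewrite /k ge_min lexx.
have kM : k * M <= e / 16.
  by rewrite -ler_pdivlMr// -mulrA -invfM /k ge_min lexx orbT.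
have l1 : 0 < 1 + l by rewrite addr_gt0.
exists (k * r / (1 + l)) => [|q1 q2]; first by rewrite divr_gt0 ?mulr_gt0.
have small q : `|q - v| < k * r / (1 + l) ->
    body C (p + (1 + k)^-1 *: q) /\ body C (p + (1 + k)^-1 *: - (l *: q)).
  rewrite ltr_pdivlMr// mulrDr mulr1 => qv.
  have qv0 : 0 <= `|q - v| * l by rewrite mulr_ge0// ltW.
  have qv1 : 0 <= `|q - v| by [].
  split.
    rewrite -[q](subrKC v); apply: (in_homothety hr k0 Kv); lra.
  rewrite -[q in l *: q](subrKC v) scalerDr opprD.
  apply: (in_homothety hr k0 Klv).
  by rewrite normrN normrZ gtr0_norm// mulrC; lra.
move=> /small[q1a q1b] /small[q2a q2b].
have [D [CD xD minD]] := hull_exists C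
  [:: p + q1; p + q2; p - l *: q1; p - l *: q2].
exists D; split => //.
have DC x : body D x -> body C (p + (1 + k)^-1 *: (x - p)).
  move: x; apply: minD; first exact: convex_homothety.
    move=> x Kx /=; rewrite -[x - p]addr0; apply: (in_homothety hr k0).
      by rewrite subrKC.
    by rewrite normr0 mulr_gt0.
  by move=> x; rewrite !inE => /or4P[] /eqP -> /=; rewrite [p + _ - p]addrC addKr.
have kk : 0 < 1 + k by rewrite addr_gt0.
have pM : `|p| <= M by apply: CM; exact: (interior_subset ip).
have := @hausdorff_homothety C D p k (4 * M) ip k0 CD DC.
move=> /(_ _)/le_lt_trans; apply; last by lra.
move=> x /DC/CM; set y := _ *: _ => yM.
have -> : x - p = (1 + k) *: y by rewrite scalerA mulfV ?gt_eqF// scale1r.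
have y2 : `|y| <= 2 * M.
  by rewrite -[y](addKr p) addrC (le_trans (ler_normB _ _))//; lra.
rewrite normrZ gtr0_norm//.
have : (1 + k) * `|y| <= 2 * (2 * M) by rewrite ler_pM//; lra.
lra.
Qed.

End hulls.

(** * Bodies with prescribed corners *)

Section corners.
Context {R : realType}.
Implicit Types (s : bool) (x y z v w n p a b q : 'rV[R]_2)
  (C D : convex_curve R) (K T : set 'rV[R]_2).

(** A cone with apex a.  Membership in it says that points at which n . y is
    close to its value at a are close to a, and being convex it passes to
    hulls. *)
Lemma convex_cone n a k : 0 <= k ->
  convex_set [set y : 'rV[R]_2 | `|y - a| <= k * (dot n a - dot n y)].
Proof.
move=> k0; apply/convexP => x y t /= hx hy /andP[t0 t1].
have -> : (1 - t) *: x + t *: y - a = (1 - t) *: (x - a) + t *: (y - a).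
  by apply: row2P; rewrite !mxE; ring.
apply: le_trans (ler_normD _ _) _; rewrite !normrZ !ger0_norm ?subr_ge0//.
have -> : k * (dot n a - dot n ((1 - t) *: x + t *: y)) =
    (1 - t) * (k * (dot n a - dot n x)) + t * (k * (dot n a - dot n y)).
  by rewrite dotDr !dotZr; ring.
by rewrite lerD// ler_wpM2l// subr_ge0.
Qed.

(** A strict maximum of n at a over a body and finitely many points gives a
    cone with apex a containing all of them: the body has the uniform gap g,
    and finitely many points have a positive gap each. *)
Lemma cone_bound C (xs : seq 'rV[R]_2) n a g : 0 < g ->
  (forall y, body C y -> dot n y + g <= dot n a) ->
  (forall x, x \in xs -> x = a \/ dot n x < dot n a) ->
  exists2 k, 0 < k & forall y, body C y \/ y \in xs ->
    `|y - a| <= k * (dot n a - dot n y).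
Proof.
move=> g0 hC; elim: xs => [_|x xs IH hx].
  have [M M0 CM] := body_bound C.
  have B0 : 0 < M + `|a| by rewrite ltr_pwDl.
  exists ((M + `|a|) / g); first by rewrite divr_gt0.
  move=> y [Ky|//]; rewrite (le_trans (ler_normB _ _))//.
  rewrite (le_trans (lerD (CM _ Ky) (lexx _)))// mulrAC ler_pdivlMr//.
  by rewrite ler_pM2l//; have := hC _ Ky; lra.
have [k k0 hk] := IH (fun y yx => hx y (mem_behead (s := x :: xs) yx)).
(* for x = a this is 0, division by zero giving 0 *)
pose k' := `|x - a| / `|dot n a - dot n x|.
have k'0 : 0 <= k' by rewrite divr_ge0.
exists (k + k') => [|y]; first by rewrite ltr_pwDl.
have good : body C y \/ y \in xs -> `|y - a| <= (k + k') * (dot n a - dot n y).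
  move=> /hk h; apply: le_trans (h) _; rewrite ler_wpM2r ?lerDl//.
  by rewrite -(pmulr_rge0 _ k0); exact: le_trans h.
move=> [Ky|]; first by apply: good; left.
rewrite inE => /orP[/eqP ->|yx]; last by apply: good; right.
have [->|lt] := hx x (mem_head _ _); first by rewrite !subrr normr0 mulr0.
rewrite mulrDl /k' [`|dot n a - _|]gtr0_norm ?subr_gt0// divfK ?gt_eqF ?subr_gt0//.
by rewrite lerDr mulr_ge0 ?ltW// subr_gt0.
Qed.

(** If the body lies in cones with apices a and b, every nearly maximal pair
    for n is close to (a, b), so p is on the side given by this single chord. *)
Lemma side_of_corners s D p n a b k : n != 0 -> 0 < k ->
  body D a -> body D b ->
  (forall y, body D y -> `|y - a| <= k * (dot n a - dot n y)) ->
  (forall y, body D y -> `|y - b| <= k * (dot n y - dot n b)) ->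
  0 < (-1) ^+ s * det2 (p - a) (b - a) -> side s D p n.
Proof.
move=> n0 k0 Da Db ha hb; set m := _ * det2 _ _ => m0.
have na y : curve_set D y -> dot n y <= dot n a.
  move=> /curve_sub_body/ha h; rewrite -subr_ge0 -(pmulr_rge0 _ k0).
  exact: le_trans h.
have nb y : curve_set D y -> dot n b <= dot n y.
  move=> /curve_sub_body/hb h; rewrite -subr_ge0 -(pmulr_rge0 _ k0).
  exact: le_trans h.
have Ca : curve_set D a by exact: max_in_curve na.
have Cb : curve_set D b.
  have n0' : - n != 0 by rewrite oppr_eq0.
  by apply: (max_in_curve n0') => // y Cy; rewrite !dotNl lerN2 nb.
have m20 : 0 < m / 2 by rewrite divr_gt0.
have [d d0 hd] := det2_near D p m20.
exists (Num.min (m / 2) (d / (2 * k))).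
  by rewrite lt_min m20 divr_gt0// mulr_gt0.
set e := Num.min _ _; move=> a' b' [Ca' Cb' /(_ _ _ Ca Cb)]; rewrite !dotBr => h.
have ed : k * e < d.
  apply: (@le_lt_trans _ _ (k * (d / (2 * k)))).
    by rewrite ler_pM2l// /e ge_min lexx orbT.
  by rewrite (_ : k * _ = d / 2); [lra|field; rewrite gt_eqF].
have aa : `|a - a'| < d.
  rewrite distrC; apply: le_lt_trans (ha _ (curve_sub_body Ca')) _.
  by apply: le_lt_trans ed; rewrite ler_pM2l//; have := nb _ Cb'; lra.
have bb : `|b - b'| < d.
  rewrite distrC; apply: le_lt_trans (hb _ (curve_sub_body Cb')) _.
  by apply: le_lt_trans ed; rewrite ler_pM2l//; have := na _ Ca'; lra.
have pp : `|p - p| < d by rewrite subrr normr0.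
have := hd _ _ _ _ _ Ca Cb pp aa bb.
have e1 : e <= m / 2 by rewrite /e ge_min lexx.
have := sign_lipschitz s (det2 (p - a) (b - a)) (det2 (p - a') (b' - a')).
by rewrite -/m; lra.
Qed.

(** For directions n in which q1 beats q2, the corners p0 + q1 and p0 - l q1
    carry all nearly maximal pairs.  The chord between them passes through p0,
    so the side of p is the sign of det (q1, p - p0). *)
Lemma side_of_spikes s C D p0 p n q1 q2 (l g : R) :
  let xs := [:: p0 + q1; p0 + q2; p0 - l *: q1; p0 - l *: q2] in
  (forall x, x \in xs -> body D x) ->
  (forall T, convex_set T -> body C `<=` T -> (forall x, x \in xs -> T x) ->
     body D `<=` T) ->
  n != 0 -> 0 < l -> 0 < g ->
  (forall y, body C y -> dot n (y - p0) + g <= dot n q1) ->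
  (forall y, body C y -> - (l * dot n q1) + g <= dot n (y - p0)) ->
  (q2 = q1 \/ dot n q2 < dot n q1) -> 0 < dot n q2 ->
  0 < (-1) ^+ s * det2 q1 (p - p0) -> side s D p n.
Proof.
move=> xs xD minD n0 l0 g0 h1 h2 h3 h4 h5.
have q10 : 0 < dot n q1 by case: h3 => [<-//|]; exact: lt_trans.
have lq1 : 0 < l * dot n q1 by rewrite mulr_gt0.
have lq2 : 0 < l * dot n q2 by rewrite mulr_gt0.
have [|x|k k0 hk] := @cone_bound C xs n (p0 + q1) g g0.
- by move=> y /h1; rewrite dotBr dotDr; lra.
- rewrite !inE => /or4P[] /eqP ->; first by left.
  + case: h3 => [->|lt]; [by left|by right; rewrite !dotDr ltrD2l].
  + by right; rewrite dotBr dotDr dotZr; lra.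
  + by right; rewrite dotBr dotDr dotZr; lra.
have [|x|k' k'0 hk'] := @cone_bound C xs (- n) (p0 - l *: q1) g g0.
- by move=> y /h2; rewrite !dotNl !dotBr dotZr; lra.
- rewrite !inE => /or4P[] /eqP ->.
  + by right; rewrite !dotNl dotBr dotDr dotZr; lra.
  + by right; rewrite !dotNl dotBr dotDr dotZr; lra.
  + by left.
  + case: h3 => [->|lt]; [by left|right].
    by rewrite !dotNl !dotBr !dotZr ltrN2 ltrD2l ltrN2 ltr_pM2l.
have cone k1 m a : 0 < k1 -> (forall y, body C y \/ y \in xs ->
      `|y - a| <= k1 * (dot m a - dot m y)) ->
    forall y, body D y -> `|y - a| <= k1 * (dot m a - dot m y).
  move=> k10 h; apply: minD; first exact/convex_cone/ltW.
    by move=> y Ky /=; apply: h; left.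
  by move=> y xy /=; apply: h; right.
have kk : 0 < k + k' by rewrite addr_gt0.
have grow m a k1 : 0 < k1 -> k1 <= k + k' ->
    (forall y, body D y -> `|y - a| <= k1 * (dot m a - dot m y)) ->
    forall y, body D y -> `|y - a| <= (k + k') * (dot m a - dot m y).
  move=> k10 le h y /h {}h; apply: le_trans (h) _; rewrite ler_wpM2r//.
  by rewrite -(pmulr_rge0 _ k10); exact: le_trans h.
apply: (@side_of_corners _ _ _ _ (p0 + q1) (p0 - l *: q1) (k + k')) => //.
- by apply: xD; rewrite !inE eqxx.
- by apply: xD; rewrite !inE eqxx !orbT.
- by apply: grow (cone _ _ _ k0 hk); rewrite // lerDl ltW.
- move=> y Dy; have := grow _ _ _ k'0 _ (cone _ _ _ k'0 hk') y Dy.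
  by rewrite lerDr ltW// !dotNl opprK [- _ + _]addrC; exact.
- rewrite (_ : det2 _ _ = (1 + l) * det2 q1 (p - p0)); last first.
    by rewrite /det2 !mxE; ring.
  by rewrite mulrCA mulr_gt0// addr_gt0.
Qed.

(** The point p lies strictly between the two supporting lines, hence strictly
    inside the chord. *)
Lemma chord_through_interior C n p a b : n != 0 -> interior (body C) p ->
  max_pair C n 0 a b -> det2 (p - a) (b - a) = 0 ->
  exists2 l, 0 < l & b - p = - (l *: (a - p)) /\ 0 < dot n (a - p).
Proof.
move=> n0 ip ab d0; have /max_pairP[Ca Cb ha hb] := ab.
have Kp := interior_subset ip.
have pa := dot_interior_lt n0 ip ha.
have bp : dot n b < dot n p.
  have n0' : - n != 0 by rewrite oppr_eq0.
  rewrite -ltrN2 -!dotNl; apply: (dot_interior_lt n0' ip) => x Cx.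
  by rewrite !dotNl lerN2 hb.
have d1 : det2 (b - p) (a - p) = 0.
  by rewrite -d0 /det2 !mxE; ring.
have := parallel_of_det2 n d1; rewrite !dotBr => h.
have l0 : dot n a - dot n p != 0 by rewrite gt_eqF// subr_gt0.
exists ((dot n p - dot n b) / (dot n a - dot n p)).
  by rewrite divr_gt0// subr_gt0.
split; last by rewrite subr_gt0.
by rewrite -scaleNr -mulNr opprB mulrC -scalerA -h scalerK.
Qed.

End corners.

(** * Crossing affine diameters after a small perturbation *)

Section crossing.
Context {R : realType}.
Implicit Types (s : bool) (x y z v w n p a b q : 'rV[R]_2)
  (C D : convex_curve R) (K T : set 'rV[R]_2).

Lemma rescale_lt x (d : R) : 0 < d -> `|(d / (`|x| + 1)) *: x| < d.
Proof.
move=> d0; have x1 : 0 < `|x| + 1 by rewrite ltr_wpDl.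
rewrite normrZ gtr0_norm ?divr_gt0// mulrAC ltr_pdivrMr// ltr_pM2l//.
by rewrite ltrDl.
Qed.

(** Prolonging an affine diameter through p0 at both ends makes it the only
    one with normal n0; then p is chosen next to p0, off that chord. *)
Lemma spike C p0 n0 a b s (e r : R) : n0 != 0 -> interior (body C) p0 ->
  max_pair C n0 0 a b -> det2 (p0 - a) (b - a) = 0 -> 0 < e -> 0 < r ->
  exists D p, [/\ hausdorff_dist C D < e, `|p0 - p| < r & side s D p n0].
Proof.
move=> n00 ip ab d0 e0 r0; have /max_pairP[Ca Cb ha hb] := ab.
have [l l0 [hl w0]] := chord_through_interior n00 ip ab d0.
set v := a - p0 in hl w0; set w := dot n0 v in w0.
have Kv : body C (p0 + v) by rewrite subrKC; exact: curve_sub_body.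
have Klv : body C (p0 - l *: v) by rewrite -hl subrKC; exact: curve_sub_body.
have [d d00 hd] := perturb ip l0 e0 Kv Klv.
pose ep := d / (`|v| + 1); have v1 : 0 < `|v| + 1 by rewrite ltr_wpDl.
have ep0 : 0 < ep by rewrite divr_gt0.
pose q := (1 + ep) *: v.
have qv : `|q - v| < d by rewrite /q scalerDl scale1r addrAC subrr add0r rescale_lt.
have [D [CD xD minD]] := hd _ _ qv qv.
pose t := (-1) ^+ s * (r / (`|perp n0| + 1)).
have t1 : 0 < `|perp n0| + 1 by rewrite ltr_wpDl.
exists D, (p0 + t *: perp n0); split => //.
  by rewrite opprD addNKr normrN /t -scalerA normrZ normr_sign mul1r rescale_lt.
have Ew : 0 < ep * w by rewrite mulr_gt0.
have nq : dot n0 q = w + ep * w by rewrite /q dotZr mulrDl mul1r.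
have [g0 [g00 gE gl]] : exists g : R, [/\ 0 < g, g <= ep * w & g <= l * (ep * w)].
  exists (Num.min (ep * w) (l * (ep * w))).
  by rewrite lt_min Ew mulr_gt0//= !ge_min !lexx orbT.
apply: (side_of_spikes (q1 := q) (q2 := q) (l := l) (g := g0) xD minD) => //.
- move=> y Ky; rewrite nq dotBr.
  have := max_body n00 ha Ky; rewrite /w /v dotBr in gE *; lra.
- move=> y Ky; rewrite nq dotBr.
  have := max_body (n := - n0) (c := - dot n0 b) _ _ Ky.
  rewrite !dotNl lerN2 oppr_eq0 => /(_ n00) h.
  have {}h : dot n0 b <= dot n0 y.
    by apply: h => z Cz; rewrite dotNl lerN2 hb.
  have : dot n0 b - dot n0 p0 = - (l * w).
    by rewrite -dotBr hl -scaleNr dotZr mulNr.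
  by rewrite mulrDr; lra.
- by left.
- by rewrite nq addr_gt0.
- rewrite [p0 + _]addrC addrK.
  have -> : det2 q (t *: perp n0) = (1 + ep) * t * w.
    by rewrite /w /q !dot2E /det2 !mxE /=; ring.
  rewrite /t (_ : _ * (_ * _ * _) = (1 + ep) * (r / (`|perp n0| + 1)) * w).
    by rewrite !mulr_gt0// ?addr_gt0// divr_gt0.
  rewrite [X in X = _](_ : _ = ((-1) ^+ s * (-1) ^+ s) *
    ((1 + ep) * (r / (`|perp n0| + 1)) * w)); last by ring.
  by rewrite -expr2 sqrr_sign mul1r.
Qed.

Lemma gap_estimate (A Q k X Y Z : R) : 0 < k -> k <= A / 4 ->
  X - Y <= k -> Z + A - Q <= k -> - Z <= X -> - Q + k <= Y.
Proof. by move=> *; lra. Qed.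

(** The two prolonged chords, tilted in opposite directions, cross at p0 and
    are selected by directions before and after n0 respectively.  The point p
    lies on the line of the original chord, hence between them. *)
Lemma cross C p0 n0 a b s (e r : R) : n0 != 0 -> interior (body C) p0 ->
  max_pair C n0 0 a b -> det2 (p0 - a) (b - a) = 0 -> 0 < e -> 0 < r ->
  exists D p, [/\ hausdorff_dist C D < e, `|p0 - p| < r &
    exists2 th, 0 < th & forall n, `|n0 - n| < th ->
      (det2 n0 n < 0 -> side s D p n) /\ (0 < det2 n0 n -> side (~~ s) D p n)].
Proof.
move=> n00 ip ab d0 e0 r0; have /max_pairP[Ca Cb ha hb] := ab.
have [l l0 [hl w0]] := chord_through_interior n00 ip ab d0.
set v := a - p0 in hl w0; set w := dot n0 v in w0.
have Kv : body C (p0 + v) by rewrite subrKC; exact: curve_sub_body.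
have Klv : body C (p0 - l *: v) by rewrite -hl subrKC; exact: curve_sub_body.
have [d d00 hd] := perturb ip l0 e0 Kv Klv.
have d20 : 0 < d / 2 by rewrite divr_gt0.
pose ep := d / 2 / (`|v| + 1); have v1 : 0 < `|v| + 1 by rewrite ltr_wpDl.
have ep0 : 0 < ep by rewrite divr_gt0.
pose de := d / 2 / (`|perp n0| + 1).
have t1 : 0 < `|perp n0| + 1 by rewrite ltr_wpDl.
have de0 : 0 < de by rewrite divr_gt0.
pose q (c : R) := (1 + ep) *: v + c *: perp n0.
have qv c : `|c| = de -> `|q c - v| < d.
  move=> cE; have -> : q c - v = ep *: v + c *: perp n0.
    by rewrite /q scalerDl scale1r -(addrA v) [LHS]addrC addKr.
  rewrite (le_lt_trans (ler_normD _ _))// [ltRHS]splitr ltrD ?rescale_lt//.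
  by rewrite normrZ cE -[de]gtr0_norm// -normrZ rescale_lt.
have qB c : `|c| = de -> `|q c| <= `|v| + d.
  move=> /qv h; rewrite -[q c](subrKC v) (le_trans (ler_normD _ _))// lerD2l ltW//.
have deE : `|de| = de by exact: gtr0_norm.
have dNE : `|- de| = de by rewrite normrN.
have qv1 := qv _ dNE; have qv2 := qv _ deE.
have [D [CD xD minD]] := hd _ _ qv1 qv2.
(* the direction of the shift along the chord decides the side *)
pose t := (-1) ^+ s * (r / (`|v| + 1)).
exists D, (p0 + t *: v); split => //.
  by rewrite opprD addNKr normrN /t -scalerA normrZ normr_sign mul1r rescale_lt.
have Ew : 0 < ep * w by rewrite mulr_gt0.
have lEw : 0 < l * (ep * w) by rewrite mulr_gt0.
(* The corners exceed the body by ep * w in direction n0 and by l * ep * w in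
   direction - n0; a quarter of this survives for directions n close to n0. *)
pose k := Num.min (ep * w) (l * (ep * w)) / 4.
have k0 : 0 < k by rewrite divr_gt0// lt_min Ew.
have kE : k <= ep * w / 4 by rewrite ler_pM2r// ge_min lexx.
have kl : k <= l * (ep * w) / 4 by rewrite ler_pM2r// ge_min lexx orbT.
have [M M0 CM] := body_bound C.
pose B := 2 * M + `|v| + d; have B0 : 0 < B by rewrite /B; have := normr_ge0 v; lra.
have l1 : 0 < 1 + l by rewrite addr_gt0.
exists (k / (2 * B * (1 + l))); first by rewrite divr_gt0// !mulr_gt0.
move=> n nn.
have close x : `|x| <= B -> `|dot n0 x - dot n x| * (1 + l) <= k.
  move=> xB; rewrite (_ : dot n0 x - dot n x = dot (n0 - n) x); last first.
    by rewrite !dot2E !mxE; ring.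
  move: nn; rewrite ltr_pdivlMr ?mulr_gt0// => nn.
  apply: le_trans (ltW nn); rewrite !mulrA ler_pM2r//.
  apply: le_trans (norm_dot_le _ _) _.
  by rewrite mulrCA mulrA ler_wpM2l// mulr_ge0.
have pM : `|p0| <= M by apply: CM; exact: (interior_subset ip).
have yB y : body C y -> `|y - p0| <= B.
  move=> /CM yM; have := normB_le2 yM pM; rewrite /B; have := normr_ge0 v; lra.
have dq c : dot n0 (q c) = w + ep * w.
  by rewrite /q dotDr !dotZr mulrDl mul1r dot_perp /det2 -/w; ring.
have close' x : `|x| <= B -> `|dot n0 x - dot n x| <= k /\
    l * `|dot n0 x - dot n x| <= k.
  move=> /close; move: (`|_ - _|) (normr_ge0 (dot n0 x - dot n x)) => u u0.
  have := mulr_ge0 (ltW l0) u0; move: u0.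
  by rewrite mulrDr mulr1 mulrC; clear; split; lra.
have qb c : `|c| = de -> `|q c| <= B.
  by move=> /qB h; apply: le_trans h _; rewrite /B; lra.
have core s' c c' : `|c| = de -> `|c'| = de -> c' * det2 n0 n < c * det2 n0 n ->
    0 < (-1) ^+ s' * det2 (q c) (t *: v) ->
    (forall x, x \in [:: p0 + q c; p0 + q c'; p0 - l *: q c; p0 - l *: q c'] ->
       body D x) ->
    (forall T, convex_set T -> body C `<=` T -> (forall x,
       x \in [:: p0 + q c; p0 + q c'; p0 - l *: q c; p0 - l *: q c'] -> T x) ->
       body D `<=` T) ->
    side s' D (p0 + t *: v) n.
  move=> cE cE' lt sg xs mn.
  have [a1 a2] := close' _ (qb _ cE); have [a3 _] := close' _ (qb _ cE').
  have := ler_norm (dot n0 (q c) - dot n (q c)) => b1.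
  have := ler_norm (dot n0 (q c') - dot n (q c')) => b3.
  have b2 := ler_wpM2l (ltW l0) b1.
  rewrite (dq c) in a1 a2 b1 b2; rewrite (dq c') in a3 b3.
  have nn0 : n != 0.
    by apply/eqP => n0E; move: lt; rewrite n0E /det2 !mxE !mulr0 subrr !mulr0 ltxx.
  apply: (side_of_spikes (q1 := q c) (q2 := q c') (l := l) (g := k) xs mn) => //.
  - move=> y Ky; have [c1 _] := close' _ (yB _ Ky).
    have := ler_norm (- (dot n0 (y - p0) - dot n (y - p0))); rewrite normrN => c2.
    have : dot n0 (y - p0) <= w.
      by rewrite /w /v !dotBr lerD2r; exact: (max_body n00 ha Ky).
    by move: c1 c2 a1 b1 kE k0; clear; lra.
  - move=> y Ky; have [c1 _] := close' _ (yB _ Ky).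
    have c2 := ler_norm (dot n0 (y - p0) - dot n (y - p0)).
    have h : dot n0 b <= dot n0 y.
      have n00' : - n0 != 0 by rewrite oppr_eq0.
      rewrite -lerN2 -!dotNl; apply: (max_body n00' _ Ky) => z Cz.
      by rewrite !dotNl lerN2 hb.
    have f1 := le_trans b2 a2.
    apply: (gap_estimate (A := l * (ep * w)) (Z := l * w) k0 kl (le_trans c2 c1)).
      by move: f1; rewrite mulrBr mulrDr.
    have : dot n0 b - dot n0 p0 = - (l * w).
      by rewrite -dotBr hl -scaleNr dotZr mulNr.
    by move=> <-; rewrite dotBr lerD2r.
  - by right; rewrite /q !dotDr !dotZr !dot_perp ltrD2l.
  - by move: a3 b3 kE k0 w0; clear; lra.
  - by rewrite [p0 + _]addrC addrK.
have cross_det c : det2 (q c) (t *: v) = - c * (t * w).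
  by rewrite /w /q !dot2E /det2 !mxE /=; ring.
have tw : 0 < (-1) ^+ s * (t * w).
  by rewrite /t mulrA mulr_gt0// [X in 0 < X]mulrA -expr2 sqrr_sign mul1r divr_gt0.
split=> dn.
- apply: (core s (- de) de dNE deE _ _ xD minD).
  + by have : de * det2 n0 n < 0; [rewrite pmulr_rlt0|rewrite mulNr; clear; lra].
  + by rewrite cross_det opprK mulrCA mulr_gt0.
- apply: (core (~~ s) de (- de) deE dNE).
  + by have : 0 < de * det2 n0 n; [rewrite mulr_gt0|rewrite mulNr; clear; lra].
  + by rewrite cross_det signrN !mulNr mulrN opprK mulrCA mulr_gt0.
  + by move=> x; rewrite !inE => /or4P[] /eqP ->; apply: xD; rewrite !inE eqxx ?orbT.
  + move=> T cT CT xT; apply: minD => // x.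
    by rewrite !inE => /or4P[] /eqP ->; apply: xT; rewrite !inE eqxx ?orbT.
Qed.

End crossing.

(** * Baire category *)

Section category.

Lemma nowhere_denseP (T : topologicalType) (A : set T) :
  (forall (x : T) (U : set T), A x -> nbhs x U ->
     exists (y : T) (V : set T), [/\ U y, nbhs y V & V `&` A = set0]) ->
  nowhere_dense A.
Proof.
move=> h; rewrite /nowhere_dense -subset0 => x ix.
have ox : nbhs x (interior (closure A)) by apply/nbhs_interior.
have [a [Aa ia]] := interior_subset ix _ ox.
have oa : nbhs a (interior (closure A)) by apply/nbhs_interior.
have [y [V [iy Vy VA]]] := h _ _ Aa oa.
have [z [Az Vz]] := interior_subset iy _ Vy.
by have : (V `&` A) z by []; rewrite VA.
Qed.

Lemma meagre_cover (T : topologicalType) (I : countType) (F : I -> set T) A :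
  (forall i, nowhere_dense (F i)) -> A `<=` \bigcup_i F i -> meagre A.
Proof.
move=> ndF AF.
(* [meagre] asks for equality with the union, hence the intersections with A *)
exists (fun n => if unpickle n is Some i then A `&` F i else set0).
  move=> n; case: unpickle => [i|]; last by rewrite /nowhere_dense closure0 interior0.
  rewrite /nowhere_dense -subset0 -(ndF i).
  by apply/interiorS/closureS => x [].
apply/seteqP; split=> [x Ax|x [n _]]; last by case: unpickle => // i [].
have [i _ Fix] := AF _ Ax; exists (pickle i) => //.
by rewrite pickleK.
Qed.

End category.

Section generic.
Context {R : realType}.
Implicit Types (s : bool) (x y z v w n p a b : 'rV[R]_2)
  (C D : convex_curve R).

(** A countable base of the plane. *)
Definition box (q : (rat * rat) * (rat * rat)) : set 'rV[R]_2 :=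
  [set x | ratr q.1.1 < x 0 0 < ratr q.1.2 /\ ratr q.2.1 < x 0 1 < ratr q.2.2].

Lemma rat_pinch (t d : R) : 0 < d -> exists qr : rat * rat,
  t - d < ratr qr.1 < t /\ t < ratr qr.2 < t + d.
Proof.
move=> d0; have [|q] := @rat_in_itvoo R (t - d) t; first lra.
have [|r] := @rat_in_itvoo R t (t + d); first lra.
by rewrite !in_itv/= => h1 h2; exists (q, r).
Qed.

Lemma box_basis x d : 0 < d -> exists2 q, box q x & forall y, box q y -> `|x - y| < d.
Proof.
move=> d0; have [q0 [/andP[h1 h2] /andP[h3 h4]]] := rat_pinch (x 0 0) d0.
have [q1 [/andP[k1 k2] /andP[k3 k4]]] := rat_pinch (x 0 1) d0.
exists (q0, q1); first by rewrite /box /= h2 h3 k2 k3.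
move=> y [/andP[/= a1 a2] /andP[/= a3 a4]]; apply: norm2_lt; rewrite !mxE;
  rewrite ltr_norml; apply/andP; split; lra.
Qed.

Lemma box_open q x : box q x -> exists2 d, 0 < d & forall y, `|x - y| < d -> box q y.
Proof.
move=> [/andP[a1 a2] /andP[a3 a4]].
pose d := Num.min (Num.min (x 0 0 - ratr q.1.1) (ratr q.1.2 - x 0 0))
  (Num.min (x 0 1 - ratr q.2.1) (ratr q.2.2 - x 0 1)).
exists d => [|y xy]; first by rewrite !lt_min !subr_gt0 a1 a2 a3 a4.
have := le_lt_trans (coord_le_norm (x - y) 0) xy.
have := le_lt_trans (coord_le_norm (x - y) 1) xy.
rewrite !mxE /d !lt_min !ltr_norml => h1 h2; split; apply/andP; split; lra.
Qed.

(** Conditions are indexed by a countable type.  [None] stands for the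
    starting condition, and [Some (s, (al, be))] for the branching of a sign
    change between the directions of parameters al and be. *)
Definition premise (i : option (bool * (rat * rat))) C p : Prop :=
  if i is Some (s, (al, be)) then
    [/\ -1 <= ratr al :> R, al < be, ratr be <= 1 :> R,
        side s C p (dir (ratr al)) & side (~~ s) C p (dir (ratr be))]
  else True.

(** For [None], being on a side at dir 1 means being on the other one at its
    opposite dir (-1).  Otherwise the reversed change between r and r' leaves
    a change of the original kind both from al to r and from r' to be. *)
Definition splits (i : option (bool * (rat * rat))) C p : Prop :=
  if i is Some (s, (al, be)) then
    exists r r' : rat, [/\ al < r, r < r', r' < be,
      side (~~ s) C p (dir (ratr r)) & side s C p (dir (ratr r'))]
  else exists s, side s C p (dir 1).

Lemma hausdorff_distxx C : hausdorff_dist C C = 0.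
Proof. exact: (@mdistxx R (convex_curve R)). Qed.

Lemma side_open_at s C p (n : 'rV[R]_2) : side s C p n -> exists2 d, 0 < d &
  forall D p', hausdorff_dist C D < d -> `|p - p'| < d -> side s D p' n.
Proof.
move=> /side_open[d d0 h]; exists d => // D p' CD pp; apply: h => //.
by rewrite subrr normr0.
Qed.

Lemma premise_open i C p : premise i C p -> exists2 d, 0 < d &
  forall p', `|p - p'| < d -> premise i C p'.
Proof.
case: i => [[s [al be]]|]; last by exists 1.
move=> /= [h1 h2 h3 /side_open_at[d d0 hd] /side_open_at[d' d'0 hd']].
exists (Num.min d d'); first by rewrite lt_min d0.
move=> p'; rewrite lt_min => /andP[pp pp']; split => //; [apply: hd|apply: hd'] => //;
  by rewrite hausdorff_distxx.
Qed.

Lemma splits_open i C p : splits i C p -> exists2 d, 0 < d &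
  forall D p', hausdorff_dist C D < d -> `|p - p'| < d -> splits i D p'.
Proof.
case: i => [[s [al be]]|] /=; last first.
  by move=> [s /side_open_at[d d0 hd]]; exists d => // D p' *; exists s; exact: hd.
move=> [r [r' [h1 h2 h3 /side_open_at[d d0 hd] /side_open_at[d' d'0 hd']]]].
exists (Num.min d d'); first by rewrite lt_min d0.
move=> D p'; rewrite !lt_min => /andP[CD CD'] /andP[pp pp'].
by exists r, r'; split => //; [apply: hd|apply: hd'].
Qed.

(** If p0 is not yet on a side at the direction concerned, respectively at
    some direction provided by the sign change, then an affine diameter passes
    through p0 and the perturbations [spike] and [cross] apply. *)
Lemma splits_dense i C p0 (e r : R) : interior (body C) p0 -> premise i C p0 ->
  0 < e -> 0 < r -> exists D p,
  [/\ hausdorff_dist C D < e, `|p0 - p| < r & splits i D p].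
Proof.
move=> ip; have Kp := interior_subset ip.
case: i => [[s [al be]]|] /=; last first.
  move=> _ e0 r0; have [[s h]|h] := pselect (exists s, side s C p0 (dir 1)).
    by exists C, p0; split; [rewrite hausdorff_distxx|rewrite subrr normr0|exists s].
  have h' s : ~ side s C p0 (dir 1) by move=> hs; apply: h; exists s.
  have [a [b [ab d0]]] := chord_through (dir_neq0 1) Kp h'.
  have [D [p [CD pp sp]]] := spike true (dir_neq0 1) ip ab d0 e0 r0.
  by exists D, p; split => //; exists true.
move=> [al1 ab be1 sal sbe] e0 r0.
have abR : ratr al < ratr be :> R by rewrite ltr_rat.
have [|||t /andP[t1 t2] nt] := @side_ivt R s C p0 (ratr al) (ratr be).
- exact: ltW.
- exact: side_excl.
- by move=> h; exact: (side_excl h).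
have tal : ratr al < t.
  by rewrite lt_neqAle t1 andbT; apply/eqP => E; apply: (nt s); rewrite -E.
have tbe : t < ratr be.
  by rewrite lt_neqAle t2 andbT; apply/eqP => E; apply: (nt (~~ s)); rewrite E.
have [a [b [mab d0]]] := chord_through (dir_neq0 t) Kp nt.
have [D [p [CD pp [th th0 hth]]]] := cross (~~ s) (dir_neq0 t) ip mab d0 e0 r0.
have [d dd0 hd] := dir_near t th0.
have m0 : 0 < Num.min d (Num.min (t - ratr al) (ratr be - t)).
  by rewrite !lt_min dd0 !subr_gt0 tal.
have [[r1 r2] [/= /andP[h1 h2] /andP[h3 h4]]] := rat_pinch t m0.
set m := Num.min _ _ in m0 h1 h4.
have md : m <= d by rewrite /m ge_min lexx.
have ma : m <= t - ratr al by rewrite /m !ge_min lexx ?orbT.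
have mb : m <= ratr be - t by rewrite /m !ge_min lexx ?orbT.
have pos (u : R) : ratr al < u -> u < ratr be -> 0 < 1 + t * u.
  move=> u1 u2; have k1 : 0 < (1 + t) * (1 + u) by rewrite mulr_gt0//; lra.
  have k2 : 0 < (1 - t) * (1 - u) by rewrite mulr_gt0//; lra.
  lra.
exists D, p; split => //; exists r1, r2; split.
- rewrite -(ltr_rat R); lra.
- rewrite -(ltr_rat R); exact: lt_trans h3.
- rewrite -(ltr_rat R); lra.
- have [] := hth (dir (ratr r1)).
    by apply: hd; rewrite gtr0_norm; lra.
  move=> + _; apply; rewrite det2_dir pmulr_llt0 ?pos//; lra.
- have [] := hth (dir (ratr r2)).
    by apply: hd; rewrite ltr0_norm; lra.
  move=> _; rewrite negbK; apply; rewrite det2_dir pmulr_lgt0 ?pos//; lra.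
Qed.

(** Excluding these countably many nowhere dense sets of curves is what makes
    the conditions generic in p. *)
Definition stuck (qi : ((rat * rat) * (rat * rat)) * option (bool * (rat * rat))) :
    set (convex_curve R) :=
  [set C | [/\ box qi.1 !=set0,
     forall x, box qi.1 x -> interior (body C) x /\ premise qi.2 C x &
     forall x, box qi.1 x -> ~ splits qi.2 C x]].

(** A perturbation satisfying the condition at one point of the box exists
    arbitrarily close to C, and the condition persists around it. *)
Lemma stuck_nowhere_dense qi : nowhere_dense (stuck qi).
Proof.
case: qi => q i; apply: nowhere_denseP => C U [[p0 /= qp0] h _] /nbhs_ballP[e /= e0 eU].
have [ip prem] := h _ qp0; have [r r0 hr] := box_open qp0.
have [D [p [CD pp spl]]] := splits_dense ip prem e0 r0.
have [d d0 hd] := splits_open spl.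
exists D, (ball D d); split; [exact: eU|exact: nbhsx_ballx|].
rewrite -subset0 => E [DE [/= _ _ /(_ p (hr _ pp))]]; apply.
by apply: hd; rewrite ?subrr ?normr0.
Qed.

Lemma nbhs_set_val (K : set 'rV[R]_2) (u : set_type K) (U : set (set_type K)) :
  nbhs u U <-> exists2 e, 0 < e &
    forall u', `|set_val u - set_val u'| < e -> U u'.
Proof.
split.
  case=> _ /= [] [W oW <- /= Wx sWU].
  have /nbhs_ballP[e /= e0 eW] := open_nbhs_nbhs (conj oW Wx).
  by exists e => // u' uu; apply: sWU => /=; apply: eW; rewrite -ball_normE.
move=> [e /= e0 eU]; exists (set_val @^-1` ball (set_val u) e).
  split; first by exists (ball (set_val u) e) => //; exact: ball_open.
  by rewrite /= -ball_normE /= subrr normr0.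
by move=> u' /=; rewrite -ball_normE; exact: eU.
Qed.

(** A point of the body where a condition fails is a limit of interior points,
    and any box around such a point, on which the premise holds, contains
    points where the condition holds robustly. *)
Lemma splitting_comeagre C : (forall qi, ~ stuck qi C) ->
  comeagre [set u : set_type (body C) |
    forall i, premise i C (set_val u) -> splits i C (set_val u)].
Proof.
move=> ns; pose F i := [set u : set_type (body C) |
  premise i C (set_val u) /\ ~ splits i C (set_val u)].
apply: (@meagre_cover _ _ F); last first.
  move=> u /= /existsNP[i /not_implyP[h1 h2]]; exists i => //.
move=> i; apply: nowhere_denseP => u U [prem nspl] /nbhs_set_val[e e0 eU].
have [d d0 hd] := premise_open prem.
have m0 : 0 < Num.min e d by rewrite lt_min e0.
set m := Num.min _ _ in m0.
have [_ _ [c ic]] := (body_spec C).1.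
have Ku : body C (set_val u) by exact/set_mem/valP.
(* x is an interior point of the body near u, on the segment towards c *)
pose x1 := c - set_val u.
have x10 : 0 < `|x1| + 1 by rewrite ltr_wpDl.
pose t := Num.min 1 (m / (`|x1| + 1)).
have t0 : 0 < t by rewrite lt_min ltr01 divr_gt0.
have t1 : t <= 1 by rewrite /t ge_min lexx.
have tm : t <= m / (`|x1| + 1) by rewrite /t ge_min lexx orbT.
pose x := set_val u + t *: x1.
have ix : interior (body C) x.
  rewrite (_ : x = (1 - (1 - t)) *: c + (1 - t) *: set_val u).
    by apply: interior_convex => //; apply/andP; split; lra.
  by rewrite /x /x1; apply: row2P; rewrite !mxE; ring.
have ux : `|set_val u - x| < m.
  rewrite /x opprD addNKr normrN normrZ gtr0_norm//.
  apply: le_lt_trans (ler_wpM2r _ tm) _ => //.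
  by rewrite mulrAC ltr_pdivrMr// ltr_pM2l// ltrDl.
have [r r0 hr] := (interior_ball _ _).1 ix.
have k0 : 0 < Num.min (r / 2) (m - `|set_val u - x|).
  by rewrite lt_min divr_gt0//= subr_gt0.
have [q qx hq] := box_basis x k0.
have near y : box q y -> interior (body C) y /\ `|set_val u - y| < m.
  move=> /hq; rewrite lt_min => /andP[xy1 xy2]; split.
    apply/interior_ball; exists (r / 2); first by rewrite divr_gt0.
    move=> z zr; rewrite -(subrKC x y) -addrA; apply: hr.
    by rewrite (le_lt_trans (ler_normD _ _))// distrC; lra.
  rewrite -(subrKA x) (le_lt_trans (ler_normD _ _))//; lra.
have [p [qp spl]] : exists p, box q p /\ splits i C p.
  apply: contrapT => h; apply: (ns (q, i)); split => /=; first by exists x.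
    move=> y /near[iy]; rewrite lt_min => /andP[_ yd]; split => //; exact: hd.
  by move=> y qy sy; apply: h; exists y.
have [ip up] := near _ qp.
have Kp := interior_subset ip.
have [d' d'0 hd'] := splits_open spl.
exists (SigSub (mem_set Kp)), [set u' | `|p - set_val u'| < d']; split.
- by apply: eU => /=; move: up; rewrite lt_min => /andP[].
- by apply/nbhs_set_val; exists d'.
- rewrite -subset0 => u' [/= pu [_]]; apply; apply: hd' => //.
  by rewrite hausdorff_distxx.
Qed.

End generic.

(** * Counting the affine diameters through a point *)

Section cardinality.

Lemma card_le_inj (T U : Type) (A : set T) (B : set U) (f : T -> U) :
  {in A &, injective f} -> (forall x, A x -> B (f x)) -> A #<= B.
Proof.
move=> fi AB; have := inj_card_eq fi; rewrite card_eq_le => /andP[_ h].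
by apply: card_le_trans h _; apply: subset_card_le => _ [x Ax <-]; exact: AB.
Qed.

Lemma card_le_cantor (I : countType) : [set: I -> bool] #<= [set: nat -> bool].
Proof.
apply: (@card_le_inj _ _ _ _
  (fun (h : I -> bool) k => if unpickle k is Some i then h i else false)) => //.
move=> h h' _ _ E; apply/funext => i.
by have := congr1 (@^~ (pickle i)) E; rewrite pickleK.
Qed.

(** A real number is determined by the rationals below it. *)
Lemma card_le_real_cantor (R : realType) : [set: R] #<= [set: nat -> bool].
Proof.
apply: card_le_trans (card_le_cantor rat).
apply: (@card_le_inj _ _ _ _ (fun (x : R) (q : rat) => ratr q < x)) => // x y _ _ h.
have key (u v : R) : u < v -> (fun q : rat => ratr q < u) = (fun q => ratr q < v) ->
    False.
  move=> /rat_in_itvoo[q]; rewrite in_itv/= => /andP[uq qv] /(congr1 (@^~ q)).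
  by rewrite qv ltNge (ltW uq).
by apply/eqP; case: ltgtP => // /key k; [case: (k h)|case: (k (esym h))].
Qed.

End cardinality.

Section branching.
Context {R : realType}.
Implicit Types (x y z v w n p a b : 'rV[R]_2) (C D : convex_curve R).

Lemma segment_endpoints a b a' b' : a != b -> segment a b = segment a' b' ->
  (a' = a /\ b' = b) \/ (a' = b /\ b' = a).
Proof.
move=> ab E.
have inl u v : segment u v u.
  by exists 0; [rewrite /= in_itv/= lexx ler01|rewrite subr0 scale1r scale0r addr0].
have inr u v : segment u v v.
  by exists 1; [rewrite /= in_itv/= lexx ler01|rewrite subrr scale1r scale0r add0r].
have := inl a' b'; rewrite -E => -[t' /=]; rewrite in_itv/= => /andP[t'0 t'1] ea'.
have := inr a' b'; rewrite -E => -[r' /=]; rewrite in_itv/= => /andP[r'0 r'1] eb'.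
have := inl a b; rewrite E => -[t /=]; rewrite in_itv/= => /andP[t0 t1] ea.
have := inr a b; rewrite E => -[u /=]; rewrite in_itv/= => /andP[u0 u1] eb.
have ba : b - a != 0 by rewrite subr_eq0 eq_sym.
have h1 : (1 - t) * t' + t * r' = 0.
  apply/eqP; have : ((1 - t) * t' + t * r') *: (b - a) == 0.
    rewrite -(subrr a) -{2}ea -ea' -eb'; apply/eqP; apply: row2P; rewrite !mxE; ring.
  by rewrite scaler_eq0 (negPf ba) orbF.
have h2 : (1 - u) * t' + u * r' = 1.
  apply/eqP; rewrite -subr_eq0; have : ((1 - u) * t' + u * r' - 1) *: (b - a) == 0.
    rewrite -(subrr b) -{2}eb -ea' -eb'; apply/eqP; apply: row2P; rewrite !mxE; ring.
  by rewrite scaler_eq0 (negPf ba) orbF.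
have p1 : 0 <= (1 - t) * t' by rewrite mulr_ge0// subr_ge0.
have p2 : 0 <= t * r' by rewrite mulr_ge0.
have [/eqP|t'n0] := eqVneq t' 0.
  move=> /eqP t'E; left; rewrite -ea' -eb' t'E subr0 scale1r scale0r addr0; split => //.
  have r1 : r' = 1.
    have : u * r' = 1 by rewrite -h2 t'E mulr0 add0r.
    have : u * r' <= r' by rewrite ler_piMl.
    lra.
  by rewrite r1 subrr scale0r add0r scale1r.
have tE : t = 1.
  have /eqP : (1 - t) * t' = 0 by lra.
  by rewrite mulf_eq0 (negPf t'n0) orbF subr_eq0 => /eqP.
have r0 : r' = 0 by rewrite -[r']mul1r -tE; lra.
have t1' : t' = 1.
  have := h2; rewrite r0 mulr0 addr0.
  have : (1 - u) * t' <= t' by rewrite ler_piMl// lerBlDr lerDl.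
  lra.
right; rewrite -ea' -eb' t1' r0 subrr subr0 !scale0r !scale1r add0r addr0.
by split.
Qed.

(** Maximality of a fixed pair is a system of inequalities that are linear and
    homogeneous in the direction. *)
Lemma max_pair_cone C n1 n2 n a b (k c1 c2 : R) :
  0 < k -> 0 <= c1 -> 0 <= c2 -> k *: n = c1 *: n1 + c2 *: n2 ->
  max_pair C n1 0 a b -> max_pair C n2 0 a b -> max_pair C n 0 a b.
Proof.
move=> k0 c10 c20 E [Ca Cb h1] [_ _ h2]; split => // x y Cx Cy.
rewrite addr0 -(ler_pM2l k0) -!dotZl E !dotDl !dotZl lerD// ler_wpM2l//.
  by have := h1 _ _ Cx Cy; rewrite addr0.
by have := h2 _ _ Cx Cy; rewrite addr0.
Qed.

(** If the segments coincide with the same orientation, (a, b) is maximal for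
    the directions of parameters x and y, hence for that of r in between,
    where p is strictly off the chord.  With opposite orientations, (a, b) is
    maximal for dir x and - dir y, and the cone they span contains dir (-1)
    instead. *)
Lemma separated_chords C p a b a' b' (x r y : R) s s' :
  -1 < x -> x <= r -> r <= y -> y < 1 -> x < y ->
  max_pair C (dir x) 0 a b -> max_pair C (dir y) 0 a' b' ->
  det2 (p - a) (b - a) = 0 -> side s C p (dir r) -> side s' C p (dir (-1)) ->
  segment a b <> segment a' b'.
Proof.
move=> x1 xr ry y1 xy ab ab' d0 sr sN E.
have a_b : a != b.
  by have := max_pair_lt (dir_neq0 x) ab; apply: contraTneq => ->; rewrite ltxx.
have D0 : 0 < det2 (dir x) (dir y).
  rewrite det2_dir mulr_gt0 ?subr_gt0//.
  have : 0 < (1 + x) * (1 + y) by rewrite mulr_gt0//; lra.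
  have : 0 < (1 - x) * (1 - y) by rewrite mulr_gt0//; lra.
  lra.
(* Cramer's rule in the basis dir x, dir y *)
have cramer n : det2 (dir x) (dir y) *: n =
    det2 n (dir y) *: dir x + det2 (dir x) n *: dir y.
  by apply: row2P; rewrite /det2 !mxE /=; ring.
have pos (u v : R) : -1 <= u <= 1 -> -1 <= v <= 1 -> u <= v -> 0 <= det2 (dir u) (dir v).
  move=> /andP[u0 u1] /andP[v0 v1] uv; rewrite det2_dir mulr_ge0 ?subr_ge0//.
  have : 0 <= (1 + u) * (1 + v) by rewrite mulr_ge0//; lra.
  have : 0 <= (1 - u) * (1 - v) by rewrite mulr_ge0//; lra.
  lra.
have [[Ea Eb]|[Ea Eb]] := segment_endpoints a_b E; subst a' b'.
  have abr : max_pair C (dir r) 0 a b.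
    by apply: (max_pair_cone D0 _ _ (cramer _) ab ab'); apply: pos; lra.
  by have := side_max_pair sr abr; rewrite d0 mulr0 ltxx.
have abr : max_pair C (dir (-1)) 0 a b.
  have := cramer (dir (-1)); rewrite -[X in _ + X]opprK -scaleNr -scalerN => E'.
  apply: (max_pair_cone D0 _ _ E' ab (max_pairN ab')).
    by apply: pos; lra.
  by rewrite det2_dir; have : 0 < (x + 1) * (1 - x); [rewrite mulr_gt0//; lra|lra].
by have := side_max_pair sN abr; rewrite d0 mulr0 ltxx.
Qed.

Lemma max_pair_diameter C n a b : n != 0 -> max_pair C n 0 a b ->
  affine_diameter C (segment a b).
Proof.
move=> n0 ab; have lt := max_pair_lt n0 ab; have /max_pairP[Ca Cb ha hb] := ab.
exists a, b, (line n (dot n a)), (line n (dot n b)); split => //.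
- by split => //; exists n, (dot n a).
- split => //; exists (- n), (- dot n b); split.
  + by rewrite oppr_eq0.
  + by apply/seteqP; split => x; rewrite /line /= dotNl; [move=> ->|move=> /oppr_inj].
  + by move=> x Cx /=; rewrite dotNl lerN2 hb.
- by exists n, (dot n a), (dot n b).
- move=> E; have : line n (dot n b) a by rewrite -E.
  by rewrite /line /= => h; rewrite h ltxx in lt.
Qed.

Lemma segment_closed a b : closed (segment a b).
Proof.
apply: compact_closed; first exact: norm_hausdorff.
apply: continuous_compact; last exact: segment_compact.
apply: continuous_subspaceT => t; apply: cvgD; apply: cvgZr_tmp; last exact: cvg_id.
by apply: cvgB; [exact: cvg_cst|exact: cvg_id].
Qed.

Lemma closed_sub_of_boxes (S T : set 'rV[R]_2) : closed T ->
  (forall q, (exists x, S x /\ box q x) -> exists x, T x /\ box q x) -> S `<=` T.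
Proof.
move=> cT h x Sx; apply: cT => U /nbhs_ballP[e /= e0 eU].
have [q qx hq] := box_basis x e0.
have [y [Ty qy]] := h q (ex_intro _ x (conj Sx qx)).
by exists y; split => //; apply: eU; rewrite -ball_normE /=; exact: hq.
Qed.

(** Segments are closed, so each is determined by the countable family of
    boxes that it meets. *)
Lemma card_diameters_le C (A : set (set 'rV[R]_2)) : A `<=` affine_diameter C ->
  A #<= [set: nat -> bool].
Proof.
move=> AC; apply: card_le_trans (card_le_cantor _).
apply: (@card_le_inj _ _ _ _
  (fun (S : set 'rV[R]_2) q => `[< exists x, S x /\ box q x >])) => //.
have sub S T : A T -> (fun q => `[< exists x, S x /\ box q x >]) =
    (fun q => `[< exists x, T x /\ box q x >]) -> S `<=` T.
  move=> AT E; apply: closed_sub_of_boxes.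
    by have [a [b [L [M [-> _ _ _ _]]]]] := AC _ AT; exact: segment_closed.
  move=> q Sq; have Eq := congr1 (@^~ q) E.
  by apply/asboolP; rewrite -Eq; apply/asboolP.
by move=> S T /set_mem AS /set_mem AT E; apply/seteqP; split; apply: sub.
Qed.

Context (C : convex_curve R) (p : 'rV[R]_2).
Context (splitP : forall i, premise i C p -> splits i C p).

(** The endpoints of the half-circle are opposite directions, so p is on
    different sides for them. *)
Lemma sign_change_exists : exists s, premise (Some (s, (-1, 1))) C p.
Proof.
have [s h] := @splitP None I; exists (~~ s); rewrite /= rmorphN1 rmorph1 negbK.
by split; rewrite ?lexx// dirN1; exact: sideN.
Qed.

Definition subdivision s (f : rat * rat -> rat * rat) := forall I,
  premise (Some (s, I)) C p ->
  [/\ I.1 < (f I).1, (f I).1 < (f I).2, (f I).2 < I.2,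
      side (~~ s) C p (dir (ratr (f I).1)) & side s C p (dir (ratr (f I).2))].

Lemma subdivision_exists s : exists f, subdivision s f.
Proof.
suff /choice[f fP] : forall I, exists J : rat * rat, premise (Some (s, I)) C p ->
    [/\ I.1 < J.1, J.1 < J.2, J.2 < I.2,
      side (~~ s) C p (dir (ratr J.1)) & side s C p (dir (ratr J.2))].
  by exists f.
move=> [al be]; have [h|h] := pselect (premise (Some (s, (al, be))) C p).
  by have [r [r' [? ? ? ? ?]]] := splitP h; exists (r, r').
by exists (al, be).
Qed.

(** The middle piece of each subdivision carries the reversed sign change and
    is dropped. *)
Fixpoint leaf (f : rat * rat -> rat * rat) (g : nat -> bool) k : rat * rat :=
  if k is k'.+1 then
    let I := leaf f g k' in if g k' then ((f I).2, I.2) else (I.1, (f I).1)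
  else (-1, 1).

Section tree.
Context (s : bool) (f : rat * rat -> rat * rat).
Context (s1 : premise (Some (s, (-1, 1))) C p).
Context (fP : subdivision s f).

Lemma leaf_premise g k : premise (Some (s, leaf f g k)) C p.
Proof.
elim: k => [//|k IH] /=; have := fP IH; move: IH.
case: (leaf f g k) => al be [/= h1 h2 h3 h4 h5].
case: (f _) => r r' /= [k1 k2 k3 k4 k5].
have l1 : ratr al < ratr r :> R by rewrite ltr_rat.
have l2 : ratr r < ratr r' :> R by rewrite ltr_rat.
have l3 : ratr r' < ratr be :> R by rewrite ltr_rat.
by case: (g k); split => //; lra.
Qed.

Lemma leaf_mono g k m : (k <= m)%N ->
  (leaf f g k).1 <= (leaf f g m).1 /\ (leaf f g m).2 <= (leaf f g k).2.
Proof.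
elim: m => [|m IH]; first by rewrite leqn0 => /eqP ->.
rewrite leq_eqVlt => /orP[/eqP -> //|]; rewrite ltnS => /IH [h1 h2].
have := fP (leaf_premise g m); move: h1 h2 => /=.
case: (leaf f g m) => al be /= h1 h2; case: (f _) => r r' /= [k1 k2 k3 _ _].
by case: (g m) => /=; split => //; lra.
Qed.

Lemma leaf_eq g g' k : (forall m, (m < k)%N -> g m = g' m) -> leaf f g k = leaf f g' k.
Proof.
elim: k => //= k IH h; rewrite IH ?h// => m mk; apply: h.
exact: leqW.
Qed.

(** The intervals need not shrink to a point.  By openness, p is not on side
    ~~ s at the left end of their intersection, nor on side s at its right
    end, and this is all that the intermediate value argument needs. *)
Lemma leaf_limit g : exists t : R,
  (forall k, ratr (leaf f g k).1 <= t <= ratr (leaf f g k).2) /\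
  forall s', ~ side s' C p (dir t).
Proof.
pose A := [set (ratr (leaf f g k).1 : R) | k in setT].
pose B := [set (ratr (leaf f g k).2 : R) | k in setT].
have AB k m : ratr (leaf f g k).1 <= ratr (leaf f g m).2 :> R.
  rewrite ler_rat; have [h1 _] := leaf_mono g (leq_maxl k m).
  have [_ h2] := leaf_mono g (leq_maxr k m).
  have : (leaf f g (maxn k m)).1 < (leaf f g (maxn k m)).2.
    by move: (leaf_premise g (maxn k m)); case: (leaf f g _) => ? ? [].
  by lra.
have A0 : A !=set0 by exists (ratr (leaf f g 0).1), 0%N.
have B0 : B !=set0 by exists (ratr (leaf f g 0).2), 0%N.
have uA : has_ubound A by exists (ratr (leaf f g 0).2) => _ [k _ <-].
have lB : has_lbound B by exists (ratr (leaf f g 0).1) => _ [k _ <-].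
have le_sup k : ratr (leaf f g k).1 <= sup A by apply: ub_le_sup => //; exists k.
have inf_le k : inf B <= ratr (leaf f g k).2 by apply: ge_inf => //; exists k.
have sup_le : sup A <= inf B.
  apply: ge_sup => // _ [k _ <-]; apply: lb_le_inf => // _ [m _ <-]; exact: AB.
have sides k : side s C p (dir (ratr (leaf f g k).1)) /\
    side (~~ s) C p (dir (ratr (leaf f g k).2)).
  by move: (leaf_premise g k); case: (leaf f g k) => ? ? [].
have [| |t /andP[t1 t2] nt] := side_ivt (s := s) (C := C) (p := p) sup_le.
- move=> /side_dir_open[e e0 he].
  have [_ [k _ <-] lt] := sup_adherent e0 (conj A0 uA).
  apply: (side_excl (sides k).1); apply: he.
  by rewrite ger0_norm ?subr_ge0//; lra.
- move=> /side_dir_open[e e0 he].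
  have [_ [k _ <-] lt] := inf_adherent e0 (conj B0 lB).
  apply: (side_excl (s := s)) (sides k).2; apply: he.
  by rewrite ler0_norm ?subr_le0//; lra.
- exists t; split => // k; rewrite (le_trans (le_sup k) t1)/=.
  exact: le_trans t2 (inf_le k).
Qed.

(** At the first index where two branches differ, they enter the two disjoint
    subintervals of a common interval. *)
Lemma leaf_separated g g' : g <> g' -> exists I,
  premise (Some (s, I)) C p /\
  forall t t' : R, (forall k, ratr (leaf f g k).1 <= t <= ratr (leaf f g k).2) ->
    (forall k, ratr (leaf f g' k).1 <= t' <= ratr (leaf f g' k).2) ->
    (t <= ratr (f I).1 /\ ratr (f I).2 <= t') \/
    (t' <= ratr (f I).1 /\ ratr (f I).2 <= t).
Proof.
move=> gg; have ex : exists k, g k != g' k.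
  apply: contrapT => h; apply: gg; apply/funext => k; apply/eqP.
  by apply/negPn/negP => ne; apply: h; exists k.
case: (ex_minnP ex) => k gk mink; exists (leaf f g k); split; first exact: leaf_premise.
move=> t t' /(_ k.+1) /= ht /(_ k.+1) /=.
rewrite -(@leaf_eq g g' k); last first.
  by move=> m mk; apply/eqP/negPn/negP => /mink; rewrite leqNgt mk.
move: ht gk; case: (g k); case: (g' k) => //= /andP[h1 h2] _ /andP[h3 h4].
  by right.
by left.
Qed.

End tree.

(** The branches inject into the diameters, and also, through their limit
    parameters, into the reals; this closes the circle of inequalities between
    the two cardinals. *)
Lemma card_diameters_eq : body C p ->
  [set S | affine_diameter C S /\ S p] #= [set: R].
Proof.
move=> Kp; have [s s1] := sign_change_exists; have [f fP] := subdivision_exists s.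
have [t ht] := choice (leaf_limit s1 fP).
have ch g : exists ab : 'rV[R]_2 * 'rV[R]_2,
    max_pair C (dir (t g)) 0 ab.1 ab.2 /\ det2 (p - ab.1) (ab.2 - ab.1) = 0.
  have [a [b h]] := chord_through (dir_neq0 (t g)) Kp (ht g).2.
  by exists (a, b).
have [ab hab] := choice ch.
have inner g : -1 < t g < 1.
  have [_ _ _ sm1 sp1] := s1; have [/(_ 0%N) /= /andP[h1 h2] h3] := ht g.
  move: sm1 sp1 h1 h2; rewrite rmorphN1 rmorph1 => sm1 sp1 h1 h2.
  rewrite !lt_neqAle h1 h2 !andbT; apply/andP; split; apply/eqP => E.
    by apply: (h3 s); rewrite -E.
  by apply: (h3 (~~ s)); rewrite E.
have sep g g' : g <> g' -> exists r r' : R, [/\ side (~~ s) C p (dir r), r < r' &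
    (t g <= r /\ r' <= t g') \/ (t g' <= r /\ r' <= t g)].
  move=> /(leaf_separated s1 fP)[I [prem /(_ _ _ (ht g).1 (ht g').1) h]].
  exists (ratr (f I).1), (ratr (f I).2).
  by have [_ k1 _ k2 _] := fP _ prem; split => //; rewrite ltr_rat.
have t_inj : injective t.
  move=> g g' E; apply: contrapT => /sep[r [r' [_ rr]]]; rewrite E.
  by move=> [] [h1 h2]; lra.
pose S g := segment (ab g).1 (ab g).2.
have S_inj : injective S.
  move=> g g' E; apply: contrapT => /sep[r [r' [sr rr h]]].
  have [_ _ _ sm1 _] := s1; rewrite rmorphN1 in sm1.
  have /andP[i1 i2] := inner g; have /andP[i3 i4] := inner g'.
  have [m1 d1] := hab g; have [m2 d2] := hab g'.
  case: h => -[h1 h2].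
    by apply: (separated_chords _ _ _ _ _ m1 m2 d1 sr sm1 E) => //; lra.
  by apply: (separated_chords _ _ _ _ _ m2 m1 d2 sr sm1 (esym E)) => //; lra.
rewrite card_eq_le; apply/andP; split.
  apply: card_le_trans (card_diameters_le (C := C) _) _; first by move=> T [].
  by apply: (@card_le_inj _ _ _ _ t) => // g g' _ _; exact: t_inj.
apply: card_le_trans (card_le_real_cantor R) _.
apply: (@card_le_inj _ _ _ _ S) => [g g' _ _|g _]; first exact: S_inj.
have [m d] := hab g; split; first exact: (max_pair_diameter (dir_neq0 _) m).
exact: (chord_of_det2 (dir_neq0 _) Kp m d).
Qed.

End branching.

Theorem theorem1p3 (R : realType) :
  comeagre [set C : convex_curve R |
    comeagre [set u : set_type (body C) |
      [set S | affine_diameter C S /\ S (set_val u)] #= [set: R]]].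
Proof.
apply: (@meagre_cover _ _ (@stuck R)); first exact: stuck_nowhere_dense.
move=> C /= nC; apply: contrapT => ns; apply: nC.
have /splitting_comeagre : forall qi, ~ stuck qi C.
  by move=> qi h; apply: ns; exists qi.
move=> [F ndF E]; apply: (@meagre_cover _ _ F) => // u nu.
suff : (\bigcup_n F n) u by [].
rewrite -E => h; apply: nu => /=; apply: card_diameters_eq => //.
exact/set_mem/valP.
Qed.
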